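(* Let $p\in[2,3)$, $T>0$, $v\in\mathbb{R}^n$, $A\in L^\infty([0,T],\mathbb{R}^{n\times n})$, let $\mathbf X\in\mathscr C^p([0,T],\mathbb{R}^d)$ be a rough path, and let $(\Sigma,\Sigma')\in\mathscr D^p_X([0,T],\mathbb{R}^{n\times d\times n})$ be a controlled rough path. Then there exists a unique solution $(V,V')\in\mathscr D^p_X([0,T],\mathbb{R}^n)$ with $V'=\Sigma V$ to the linear rough differential equation $$V_t=v+\int_0^tA_sV_s\,ds+\int_0^t\Sigma_sV_s\,d\mathbf X_s,\qquad t\in[0,T].$$
   Context: For $X:[0,T]\to E$, $X_{s,t}:=X_t-X_s$, and $\|X\|_{q,[s,t]}:=\big(\sup_\pi\sum_{[u,v]\in\pi}\|X_{u,v}\|^q\big)^{1/q}$ (sup over partitions $\pi$ of $[s,t]$); the same formula defines $\|R\|_{q,[s,t]}$ for two-parameter maps $R:[0,T]^2\to E$. $\mathcal C^p$: continuous paths with finite $p$-variation on $[0,T]$. A rough path $\mathbf X=(X,\mathbb X)\in\mathscr C^p([0,T],\mathbb{R}^d)$ consists of $X\in\mathcal C^p([0,T],\mathbb{R}^d)$ and a continuous $\mathbb X:[0,T]^2\to\mathbb{R}^{d\times d}$ of finite $\frac p2$-variation with $\mathbb X^{ij}_{s,t}=\mathbb X^{ij}_{s,r}+\mathbb X^{ij}_{r,t}+X^i_{s,r}X^j_{r,t}$ for all $i,j$, $s,r,t$. A controlled path $(Y,Y')\in\mathscr D^p_X([0,T],E)$ ($E$ finite-dimensional) is a pair $Y\in\mathcal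 C^p([0,T],E)$, $Y'\in\mathcal C^p([0,T],\mathcal L(\mathbb{R}^d,E))$ such that $R^Y_{s,t}:=Y_{s,t}-Y'_sX_{s,t}$ has finite $\frac p2$-variation. For $(Y,Y')\in\mathscr D^p_X([0,T],\mathbb{R}^{n\times d})$, the rough integral is $\int_s^tY_r\,d\mathbf X_r:=\lim_{|\pi|\to0}\sum_{[u,v]\in\pi}(Y_uX_{u,v}+Y'_u\mathbb X_{u,v})$ over partitions $\pi$ of $[s,t]$ with vanishing mesh. $(\Sigma_sV_s)^{ij}=\sum_k\Sigma_s^{ijk}V_s^k\in\mathbb{R}^{n\times d}$, and the rough integral in the equation is that of the controlled path $(\Sigma V,(\Sigma V)')$ with $(\Sigma V)'=\Sigma V'+\Sigma'V$ (product rule). *)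

(* Defs.v *)
From HB Require Import structures.
From mathcomp Require Import all_boot all_order all_algebra.
From mathcomp Require Import all_classical all_reals all_analysis.

Set Implicit Arguments.
Unset Strict Implicit.
Unset Printing Implicit Defensive.

Import Order.TTheory GRing.Theory Num.Theory.
Import numFieldNormedType.Exports.

Local Open Scope classical_set_scope.
Local Open Scope ring_scope.

(* Paths on [0, T] are total functions on R of which only the values on [0, T]
   matter; likewise two-parameter maps on [0, T]^2.
   A finite-dimensional space E is R^m = 'cV[R]_m, and L(R^d, E) is 'M[R]_(m, d)
   acting by *m.  R^(n x d) is identified with 'cV[R]_(n * d) by vectorisation
   (mxvec), and R^(n x d x n) with 'cV[R]_(n * d * n), the coordinate (i, j, k)
   being mxvec_index (mxvec_index i j) k. *)

Section partitions.
Context {R : realType}.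

(* With the library's itv_partition, a partition s = u_0 < ... < u_k = t is the
   sequence [:: u_1; ...; u_k] (empty if s = t); its intervals [u, v] are: *)
Definition subintervals (s : R) (pi : seq R) : seq (R * R) := zip (s :: pi) pi.

Definition mesh (s : R) (pi : seq R) : R :=
  \big[Num.max/0]_(uv <- subintervals s pi) (uv.2 - uv.1).

Definition vanishing_mesh (s t : R) : set_system (seq R) :=
  filter_from [set e : R | 0 < e]
    (fun e => [set pi | itv_partition s t pi /\ mesh s pi < e]).

End partitions.

Section variation.
Context {R : realType} {E : normedModType R}.

Definition increment (X : R -> E) (s t : R) : E := X t - X s.

Definition qvariation (q : R) (F : R -> R -> E) (s t : R) : \bar R :=
  poweR (ereal_sup
    [set (\sum_(uv <- subintervals s pi) `|F uv.1 uv.2| `^ q)%:E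
       | pi in itv_partition s t]) q^-1.

Definition finite_qvariation (q : R) (F : R -> R -> E) (T : R) : Prop :=
  (qvariation q F 0 T < +oo)%E.

Definition var_path (p T : R) (X : R -> E) : Prop :=
  {within `[0, T], continuous X} /\ finite_qvariation p (increment X) T.

End variation.

Section rough_paths.
Context {R : realType} {d : nat}.

Definition rough_path (p T : R) (X : R -> 'cV[R]_d) (XX : R -> R -> 'M[R]_d) :
    Prop :=
  [/\ var_path p T X,
      {within `[0, T] `*` `[0, T], continuous (fun st : R * R => XX st.1 st.2)},
      finite_qvariation (p / 2) XX T
    & forall s r t : R,
        `[0, T]%classic s -> `[0, T]%classic r -> `[0, T]%classic t ->
        forall i j : 'I_d,
          XX s t i j = XX s r i j + XX r t i j
                       + increment X s r i 0 * increment X r t j 0].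

Definition remainder {m : nat} (X : R -> 'cV[R]_d)
    (Y : R -> 'cV[R]_m) (Y' : R -> 'M[R]_(m, d)) (s t : R) : 'cV[R]_m :=
  increment Y s t - Y' s *m increment X s t.

Definition controlled_path {m : nat} (p T : R) (X : R -> 'cV[R]_d)
    (Y : R -> 'cV[R]_m) (Y' : R -> 'M[R]_(m, d)) : Prop :=
  [/\ var_path p T Y, var_path p T Y'
    & finite_qvariation (p / 2) (remainder X Y Y') T].

(* Chen's relation reads XX^(lj) as the integral of X^l against dX^j, while the
   last index of Y' is the direction of differentiation; whence the pairing
   sum_(j, l) Y'^(ijl) XX^(lj). *)
Definition deriv_contract {n : nat} (B : 'M[R]_(n * d, d)) (M : 'M[R]_d) :
    'cV[R]_n :=
  \col_i \sum_j \sum_l B (mxvec_index i j) l * M l j.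

Definition rough_sum {n : nat} (X : R -> 'cV[R]_d) (XX : R -> R -> 'M[R]_d)
    (Y : R -> 'M[R]_(n, d)) (Y' : R -> 'M[R]_(n * d, d))
    (s : R) (pi : seq R) : 'cV[R]_n :=
  \sum_(uv <- subintervals s pi)
     (Y uv.1 *m increment X uv.1 uv.2 + deriv_contract (Y' uv.1) (XX uv.1 uv.2)).

Definition is_rough_integral {n : nat} (X : R -> 'cV[R]_d)
    (XX : R -> R -> 'M[R]_d)
    (Y : R -> 'M[R]_(n, d)) (Y' : R -> 'M[R]_(n * d, d))
    (s t : R) (J : 'cV[R]_n) : Prop :=
  rough_sum X XX Y Y' s @ vanishing_mesh s t --> J.

End rough_paths.

Section linear_equation.
Context {R : realType} {n d : nat}.

Definition tensor_mul (S : 'cV[R]_(n * d * n)) (w : 'cV[R]_n) : 'M[R]_(n, d) :=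
  \matrix_(i, j) \sum_k S (mxvec_index (mxvec_index i j) k) 0 * w k 0.

(* The product rule: (S w)' x = S (w' x) + (S' x) w, with column l given by the
   l-th basis vector x. *)
Definition tensor_mul_deriv (S : 'cV[R]_(n * d * n)) (S' : 'M[R]_(n * d * n, d))
    (w : 'cV[R]_n) (w' : 'M[R]_(n, d)) : 'M[R]_(n * d, d) :=
  \matrix_(q, l)
    mxvec (tensor_mul S (col l w') + tensor_mul (col l S') w) 0 q.

Definition Linfty (T : R) (A : R -> 'M[R]_n) : Prop :=
  forall i j : 'I_n,
    ((fun s => A s i j) \_ `[0, T]) \in Lfun (@lebesgue_measure R) +oo%E.

Definition drift (A : R -> 'M[R]_n) (V : R -> 'cV[R]_n) (t : R) : 'cV[R]_n :=
  \col_i \int[@lebesgue_measure R]_(s in `[0, t]) (A s *m V s) i 0.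

Definition is_solution (p T : R) (v : 'cV[R]_n) (A : R -> 'M[R]_n)
    (X : R -> 'cV[R]_d) (XX : R -> R -> 'M[R]_d)
    (Sigma : R -> 'cV[R]_(n * d * n)) (Sigma' : R -> 'M[R]_(n * d * n, d))
    (V : R -> 'cV[R]_n) (V' : R -> 'M[R]_(n, d)) : Prop :=
  [/\ controlled_path p T X V V',
      forall t : R, `[0, T]%classic t -> V' t = tensor_mul (Sigma t) (V t)
    & forall t : R, `[0, T]%classic t ->
        exists J : 'cV[R]_n,
          is_rough_integral X XX
            (fun s => tensor_mul (Sigma s) (V s))
            (fun s => tensor_mul_deriv (Sigma s) (Sigma' s) (V s) (V' s))
            0 t J
          /\ V t = v + drift A V t + J].

End linear_equation.

(* Main.v *)
Require Import Defs.
From HB Require Import structures.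
From mathcomp Require Import all_boot all_order all_algebra.
From mathcomp Require Import all_classical all_reals all_analysis.
From mathcomp Require Import ess_sup_inf measurable_realfun.
From mathcomp Require Import ring lra zify.

Set Implicit Arguments.
Unset Strict Implicit.
Unset Printing Implicit Defensive.

Import Order.TTheory GRing.Theory Num.Theory.
Import numFieldNormedType.Exports.

Local Open Scope classical_set_scope.
Local Open Scope ring_scope.

(** The equation is solved by sewing together frozen-coefficient steps; no
    fixed point in a space of controlled paths is needed, because the equation
    is linear.

    Expanding the equation to second order around [s] gives the linear map
    [one_step s t x], the sum of [x], of the drift [(int_s^t A) x] and of the
    germ [Sigma_s x X_(s,t) + (Sigma_s (Sigma_s x) + Sigma'_s x) XX_(s,t)].
    By Chen's relation the composition of the steps over [s, r] and [r, t]
    differs from the step over [s, t] by an error of order three in the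
    regularity scale of [X] ([germ_chen], [one_step_defect]).  Since [p < 3],
    this is a power larger than one of an additive interval function, and such
    errors do not accumulate: this is [discrete_sewing], proved by splitting a
    chain of steps where half of the control is spent.  That lemma is stated for
    arbitrary Lipschitz maps and an arbitrary size function [N] and is used
    three times.  With [N x = |x|] it bounds the Euler schemes; with [N = 1] and
    translations as maps it is the additive sewing lemma, which compares rough
    Riemann sums with their germ; with [N x = |x| + delta] it gives uniqueness.

    Regularity is measured by additive controls: finite q-variation of [F] means
    that [|F s t|^q <= phi t - phi s] for a nondecreasing [phi]
    ([finite_qvariation_controls], [big_finite_qvariation]).  Such a [phi] need
    not be continuous, so a short interval need not have a small control.
    Smallness is recovered by giving up a little regularity: if moreover
    [F s t] tends to 0 uniformly as [t - s] does, and [alpha * q < 1], then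
    [|F s t| <= e * (phi t - phi s)^alpha] on short intervals for every [e > 0]
    ([controls_small]).  The exponent [alpha] is chosen with [alpha * p < 1]
    and [1 < alpha * 3], and all errors are measured in this
    sense, [small phi (alpha * 3)].

    Existence.  On a finite set of times the Euler scheme satisfies
    [V_t - one_step s t V_s = small], with a bound that does not depend on the
    set.  A limit along an ultrafilter of finite sets of times, pointwise in
    time, satisfies the same bound for all [s <= t] ([euler_limit]).  This
    expansion contains everything: it yields the p-variation of [V], the
    p/2-variation of its remainder, and, summed over a partition, the convergence of
    the rough Riemann sums ([solution_of_expansion]).

    Uniqueness.  Additive sewing shows that every solution has the expansion
    above ([expansion_of_solution]).  The difference of two solutions then has
    it too, by linearity, and starts at 0, so it vanishes ([flow_unique]). *)

(** * Partitions of an interval *)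

Section partitions.
Context {R : realType}.
Implicit Types (s t e h : R) (pi : seq R).

Lemma subintervals_cat s pi1 pi2 :
  subintervals s (pi1 ++ pi2) = subintervals s pi1 ++ subintervals (last s pi1) pi2.
Proof. by rewrite /subintervals; elim: pi1 s => //= x pi IH s; rewrite IH. Qed.

Lemma subintervals_rcons (f : R -> R -> R) z pi t :
  \sum_(uv <- subintervals z (rcons pi t)) f uv.1 uv.2 =
  \sum_(uv <- subintervals z pi) f uv.1 uv.2 + f (last z pi) t.
Proof.
rewrite /subintervals; elim: pi z => [|x pi IH] z /=.
  by rewrite big_seq1 big_nil add0r.
by rewrite !big_cons IH addrA.
Qed.

Lemma mesh_cons s x pi : mesh s (x :: pi) = Num.max (x - s) (mesh x pi).
Proof. by rewrite /mesh /subintervals /= big_cons. Qed.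

Lemma mesh_ge0 s pi : 0 <= mesh s pi.
Proof.
rewrite /mesh; elim/big_rec : _ => // uv x _ x0.
by rewrite le_max x0 orbT.
Qed.

Lemma mesh_cat s pi1 pi2 :
  mesh s (pi1 ++ pi2) = Num.max (mesh s pi1) (mesh (last s pi1) pi2).
Proof.
elim: pi1 s => [|x pi1 IH] s /=.
  by rewrite {2}/mesh /subintervals big_nil max_r// mesh_ge0.
by rewrite !mesh_cons IH maxA.
Qed.

Lemma subintervals_mem s t pi uv : itv_partition s t pi -> uv \in subintervals s pi ->
  [/\ s <= uv.1, uv.1 < uv.2, uv.2 <= t & uv.2 - uv.1 <= mesh s pi].
Proof.
rewrite /subintervals; elim: pi s => [|x pi IH] s //= sp.
have xp := itv_partition_cons sp.
have sx : s < x by case: sp => /= /andP[].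
have xt := itv_partition_le xp.
rewrite inE mesh_cons => /predU1P[->|uvp] /=.
  by rewrite lexx sx xt le_max lexx.
have [xu uv12 vt uvm] := IH x xp uvp.
by rewrite (le_trans (ltW sx) xu) uv12 vt le_max uvm orbT.
Qed.

Lemma sum_subintervals {V : zmodType} (f : R -> R -> V) s pi :
  \sum_(uv <- subintervals s pi) f uv.1 uv.2 =
  \sum_(i < size pi) f (nth s (s :: pi) i) (nth s (s :: pi) i.+1).
Proof.
rewrite /subintervals; elim: pi s => [|x pi IH] s /=.
  by rewrite big_nil big_ord0.
rewrite big_cons /= IH big_ord_recl /=; congr (_ + _).
apply: eq_bigr => i _ /=; congr (f _ _).
  by case: i => -[|i] ii //=; apply: set_nth_default; exact: ltnW.
by apply: set_nth_default.
Qed.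

Lemma sum_subintervals_telescope {V : zmodType} (f : R -> V) s t pi :
  itv_partition s t pi ->
  \sum_(uv <- subintervals s pi) (f uv.2 - f uv.1) = f t - f s.
Proof.
rewrite /subintervals; elim: pi s => [|x pi IH] s sp /=.
  by rewrite (itv_partition_nil sp) big_nil subrr.
by rewrite big_cons (IH x (itv_partition_cons sp)) /= addrC subrKA.
Qed.

Lemma sum_subintervals_le (f : R -> R -> R) (phi : R -> R) s t pi :
  (forall u v, s <= u -> u < v -> v <= t -> f u v <= phi v - phi u) ->
  itv_partition s t pi ->
  \sum_(uv <- subintervals s pi) f uv.1 uv.2 <= phi t - phi s.
Proof.
rewrite /subintervals; elim: pi s => [|x pi IH] s h sp /=.
  by have -> := itv_partition_nil sp; rewrite big_nil subrr.
have xp := itv_partition_cons sp.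
have sx : s < x by case: sp => /= /andP[].
have xt := itv_partition_le xp.
rewrite big_cons /=; have h1 := h s x (lexx _) sx xt.
have h2 := IH x (fun u v xu => h u v (le_trans (ltW sx) xu)) xp.
lra.
Qed.

Lemma nat_mul_ge e h : 0 < h -> exists k : nat, e <= k%:R * h.
Proof.
move=> h0; exists (Num.bound `|e / h|); rewrite -ler_pdivrMr//.
apply: (le_trans (ler_norm _)); exact/ltW/archi_boundP/normr_ge0.
Qed.

(** Greedy construction with steps [e / 2]: the mesh has to be strictly below [e]. *)
Lemma fine_partition s t e : 0 < e -> s <= t ->
  exists2 pi, itv_partition s t pi & mesh s pi < e.
Proof.
move=> e0 st; have e20 : 0 < e / 2 by rewrite divr_gt0.
have [k hk] := nat_mul_ge (t - s) e20.
suff [pi pp pm] : exists2 pi, itv_partition s t pi & mesh s pi <= e / 2.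
  by exists pi => //; apply: (le_lt_trans pm); rewrite ltr_pdivrMr// ltr_pMr// ltr1n.
elim: k s st hk => [|k IH] s st hk.
  have -> : s = t by apply: le_anti; rewrite st; move: hk; rewrite mul0r subr_le0.
  by exists [::]; [split|rewrite /mesh /subintervals big_nil ltW].
have [tse|ets] := leP (t - s) (e / 2).
  move: st; rewrite le_eqVlt => /predU1P[->|st].
    by exists [::]; [split|rewrite /mesh /subintervals big_nil ltW].
  exists [:: t]; first exact: itv_partition1.
  by rewrite mesh_cons /mesh /subintervals big_nil ge_max tse ltW.
have [||pi pp pm] := IH (s + e / 2).
- lra.
- by move: hk; rewrite -natr1 mulrDl mul1r; lra.
exists (s + e / 2 :: pi).
  by case: pp => pp1 pp2; split => //=; rewrite pp1 andbT ltrDl.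
by rewrite mesh_cons ge_max pm andbT addrAC subrr add0r.
Qed.

(** Limits along vanishing mesh are unique because partitions of arbitrarily small
    mesh exist. *)
Lemma vanishing_mesh_filter s t : s <= t -> ProperFilter (vanishing_mesh s t).
Proof.
move=> st; apply: filter_from_proper; last first.
  by move=> e /= e0; have [pi pp pm] := fine_partition e0 st; exists pi.
apply: filter_from_filter; first by exists 1 => /=.
move=> e1 e2 /= e10 e20; exists (Num.min e1 e2); first by rewrite /= lt_min e10.
by move=> pi /= [pp]; rewrite lt_min => /andP[m1 m2].
Qed.

End partitions.

(** * Controls and the scale of interval functions *)

Section controls.
Context {R : realType} (T : R).
Implicit Types (phi : R -> R) (q alpha beta : R).

(** Bounding [t - s] as well makes [phi] strictly increasing, so that a long
    interval has a large control; [small_big] relies on it. *)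
Definition is_control phi :=
  forall s t : R, 0 <= s -> s <= t -> t <= T -> t - s <= phi t - phi s.

Definition unif0 {E : normedModType R} (F : R -> R -> E) :=
  forall e : R, 0 < e -> exists2 h : R, 0 < h &
    forall s t : R, 0 <= s -> s <= t -> t <= T -> t - s <= h -> `|F s t| <= e.

(** The little-o class of order [alpha] with respect to [phi], as [t - s]
    tends to 0 uniformly in [s].  It replaces the bounds
    [|F s t| <= c * phi(s, t)^alpha] with a continuous control of the literature. *)
Definition small phi alpha {E : normedModType R} (F : R -> R -> E) :=
  forall e : R, 0 < e -> exists2 h : R, 0 < h &
    forall s t : R, 0 <= s -> s <= t -> t <= T -> t - s <= h ->
      `|F s t| <= e * (phi t - phi s) `^ alpha.

Definition big phi beta {E : normedModType R} (F : R -> R -> E) :=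
  exists2 C : R, 0 <= C &
    forall s t : R, 0 <= s -> s <= t -> t <= T ->
      `|F s t| <= C * (phi t - phi s) `^ beta.

Definition controls phi q {E : normedModType R} (F : R -> R -> E) :=
  forall s t : R, 0 <= s -> s < t -> t <= T -> `|F s t| `^ q <= phi t - phi s.

Lemma control_ge0 phi : is_control phi ->
  forall s t : R, 0 <= s -> s <= t -> t <= T -> 0 <= phi t - phi s.
Proof. by move=> c s t s0 st tT; apply: le_trans (c s t s0 st tT); rewrite subr_ge0. Qed.

Lemma control_sub phi : is_control phi ->
  forall a s t b : R, 0 <= a -> a <= s -> s <= t -> t <= b -> b <= T ->
  phi t - phi s <= phi b - phi a.
Proof.
move=> c a s t b a0 as_ st tb bT.
have s0 : 0 <= s by exact: le_trans as_.
have tT : t <= T by exact: le_trans bT.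
have := control_ge0 c a0 as_ (le_trans st tT).
have := control_ge0 c (le_trans s0 st) tb bT.
lra.
Qed.

Lemma powR_subadd phi : is_control phi -> forall alpha, 0 <= alpha ->
  forall a s t b : R, 0 <= a -> a <= s -> s <= t -> t <= b -> b <= T ->
  (phi t - phi s) `^ alpha <= (phi b - phi a) `^ alpha.
Proof.
move=> c alpha al0 a s t b a0 as_ st tb bT.
have s0 : 0 <= s by exact: le_trans as_.
apply: ge0_ler_powR => //; last exact: control_sub.
  by rewrite nnegrE; apply: control_ge0 => //; exact: le_trans bT.
rewrite nnegrE; apply: control_ge0 => //.
by rewrite (le_trans as_)// (le_trans st).
Qed.

Context {E : normedModType R}.
Implicit Types F : R -> R -> E.

Lemma finite_qvariationP q F : 0 < q ->
  (exists C, forall pi, itv_partition 0 T pi ->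
     \sum_(uv <- subintervals 0 pi) `|F uv.1 uv.2| `^ q <= C) <->
  finite_qvariation q F T.
Proof.
move=> q0; rewrite /finite_qvariation /qvariation; set S := ereal_sup _.
split=> [[C hC]|].
  suff : (S < +oo)%E by move=> h; exact: poweR_lty.
  apply: (@le_lt_trans _ _ C%:E); last exact: ltry.
  by apply: ge_ereal_sup => _ [pi ppi <-]; rewrite lee_fin; exact: hC.
move=> h; have Sub pi : itv_partition 0 T pi ->
  ((\sum_(uv <- subintervals 0 pi) `|F uv.1 uv.2| `^ q)%:E <= S)%E.
  by move=> ppi; apply: ereal_sup_ubound; exists pi.
have {h} := lty_poweRy (lt0r_neq0 (ltac:(by rewrite invr_gt0) : 0 < q^-1)) h.
case E1 : S Sub => [r| |] // Sub _; first by exists r => pi /Sub; rewrite lee_fin.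
by exists 0 => pi /Sub; rewrite leeNy_eq.
Qed.

(** Take for [phi t] the supremum of the variation sums over [0, t].  A partition
    of [0, s] followed by the point [t] is a partition of [0, t]; hence the
    superadditive variation already dominates the additive function
    [phi t - phi s]. *)
Lemma finite_qvariation_controls q F : 0 < q -> finite_qvariation q F T ->
  exists phi, controls phi q F.
Proof.
move=> q0 /(finite_qvariationP F q0)[C hC].
pose V t := [set x | exists2 pi, itv_partition 0 t pi &
  x = \sum_(uv <- subintervals 0 pi) `|F uv.1 uv.2| `^ q].
have sub_rcons s t pi : itv_partition 0 s pi -> s < t ->
  itv_partition 0 t (rcons pi t) /\
  \sum_(uv <- subintervals 0 (rcons pi t)) `|F uv.1 uv.2| `^ q =
  \sum_(uv <- subintervals 0 pi) `|F uv.1 uv.2| `^ q + `|F s t| `^ q.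
  move=> [ps /eqP ls] st; split.
    by split; rewrite ?last_rcons// rcons_path ps ls.
  by rewrite (subintervals_rcons (fun u v => `|F u v| `^ q)) ls.
have Vub t : t <= T -> has_ubound (V t).
  rewrite le_eqVlt => /predU1P[->|tT].
    by exists C => _ [pi ppi ->]; exact: hC.
  exists C => _ [pi ppi ->].
  have [pp e] := sub_rcons _ _ _ ppi tT.
  by apply: le_trans (hC _ pp); rewrite e lerDl powR_ge0.
exists (fun t => sup (V t)) => s t s0 st tT.
rewrite lerBrDr addrC -lerBrDr; apply: ge_sup.
  have [->|sn0] := eqVneq s 0; first by exists (\sum_(uv <- subintervals 0 [::]) `|F uv.1 uv.2| `^ q); exists [::].
  exists (\sum_(uv <- subintervals 0 [:: s]) `|F uv.1 uv.2| `^ q); exists [:: s] => //.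
  by apply: itv_partition1; rewrite lt_neqAle eq_sym sn0.
move=> _ [pi ppi ->]; rewrite lerBrDr.
have [pp <-] := sub_rcons _ _ _ ppi st.
by apply: ub_le_sup; [exact: Vub | exists (rcons pi t)].
Qed.

Lemma controls_le phi phi' q F : controls phi q F ->
  (forall s t : R, 0 <= s -> s < t -> t <= T -> phi t - phi s <= phi' t - phi' s) ->
  controls phi' q F.
Proof. by move=> h hh s t s0 st tT; apply: le_trans (hh s t s0 st tT); exact: h. Qed.

Lemma unif0_diag F s : unif0 F -> 0 <= s <= T -> F s s = 0.
Proof.
move=> h /andP[s0 sT]; apply/eqP; rewrite -normr_eq0 eq_le normr_ge0 andbT.
apply/ler_addgt0Pl => e e0; rewrite addr0.
by have [d d0 hd] := h e e0; apply: hd => //; rewrite subrr ltW.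
Qed.

(** Interpolation: [|F| = |F|^(1 - alpha q) * (|F|^q)^alpha], where the first
    factor is uniformly small on short intervals and the second one is bounded
    by the control. *)
Lemma controls_small phi q alpha F : is_control phi -> 0 < q -> 0 < alpha ->
  alpha * q < 1 -> unif0 F -> controls phi q F -> small phi alpha F.
Proof.
move=> cphi q0 a0 aq Fu Fc e e0.
have g0 : 0 < 1 - alpha * q by rewrite subr_gt0.
have [h h0 hh] := Fu (e `^ (1 - alpha * q)^-1) (powR_gt0 _ e0).
exists h => // s t s0 st tT sth.
have [ste|stn] := eqVneq s t.
  by subst t; rewrite (unif0_diag Fu) ?s0// normr0 mulr_ge0 ?powR_ge0// ltW.
have {}st : s < t by rewrite lt_neqAle stn.
have -> : `|F s t| = `|F s t| `^ (1 - alpha * q) * (`|F s t| `^ q) `^ alpha.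
  rewrite -powRrM -powRD; last first.
    by rewrite mulrC subrK oner_eq0.
  by rewrite mulrC subrK powRr1.
apply: ler_pM; rewrite ?powR_ge0//.
  have -> : e = (e `^ (1 - alpha * q)^-1) `^ (1 - alpha * q).
    by rewrite -powRrM mulVf ?gt_eqF// powRr1// ltW.
  apply: ge0_ler_powR; rewrite ?nnegrE ?powR_ge0 ?(ltW g0)//.
  exact: hh (ltW st) tT sth.
apply: ge0_ler_powR; rewrite ?nnegrE ?powR_ge0 ?(ltW a0)//.
  exact: control_ge0 (ltW st) tT.
exact: Fc.
Qed.

Lemma controls_big phi q F : is_control phi -> 0 < q ->
  (forall s : R, 0 <= s <= T -> F s s = 0) -> controls phi q F -> big phi q^-1 F.
Proof.
move=> cphi q0 Fd Fc; exists 1 => // s t s0 st tT; rewrite mul1r.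
have [ste|stn] := eqVneq s t.
  by subst t; rewrite Fd ?s0// normr0 powR_ge0.
have {}st : s < t by rewrite lt_neqAle stn.
have -> : `|F s t| = (`|F s t| `^ q) `^ q^-1.
  by rewrite -powRrM mulfV ?gt_eqF// powRr1.
apply: ge0_ler_powR; rewrite ?nnegrE ?powR_ge0 ?invr_ge0 ?(ltW q0)//.
  exact: control_ge0 (ltW st) tT.
exact: Fc.
Qed.

(** The control being additive, its sum over a partition telescopes. *)
Lemma big_finite_qvariation phi q F : is_control phi -> 0 < q ->
  big phi q^-1 F -> finite_qvariation q F T.
Proof.
move=> cphi q0 [C C0 hC]; apply/(finite_qvariationP F q0).
exists (C `^ q * phi T - C `^ q * phi 0) => pi ppi.
apply: (sum_subintervals_le (phi := fun t => C `^ q * phi t)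
  (f := fun u v => `|F u v| `^ q)) ppi => u v u0 uv vT.
rewrite -mulrBr.
have w0 := control_ge0 cphi u0 (ltW uv) vT.
apply: (@le_trans _ _ ((C * (phi v - phi u) `^ q^-1) `^ q)).
  apply: ge0_ler_powR; rewrite ?nnegrE ?mulr_ge0 ?powR_ge0 ?(ltW q0)//.
  exact: hC (ltW uv) vT.
by rewrite powRM ?powR_ge0// -powRrM mulVf ?gt_eqF// powRr1.
Qed.

Lemma big_weaken phi beta gamma F : is_control phi -> 0 < beta -> beta <= gamma ->
  big phi gamma F -> big phi beta F.
Proof.
move=> cphi b0; rewrite le_eqVlt => /predU1P[->//|bg] [C C0 hC].
exists (C * (phi T - phi 0) `^ (gamma - beta)); first by rewrite mulr_ge0 ?powR_ge0.
move=> s t s0 st tT; apply: (le_trans (hC s t s0 st tT)).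
rewrite -mulrA ler_wpM2l//.
have {1}-> : gamma = (gamma - beta) + beta by rewrite subrK.
rewrite powRD ?subrK; last by rewrite gt_eqF// (lt_trans b0).
rewrite ler_wpM2r ?powR_ge0//.
by apply: powR_subadd => //; rewrite subr_ge0 ltW.
Qed.

(** On intervals longer than [h] the control is at least [h], so a bound on [F]
    suffices there. *)
Lemma small_big phi beta F M : is_control phi -> 0 < beta -> small phi beta F ->
  (forall s t : R, 0 <= s -> s <= t -> t <= T -> `|F s t| <= M) -> big phi beta F.
Proof.
move=> cphi b0 Fs FM; have [h h0 hh] := Fs 1 ltr01.
exists (1 + `|M| / h `^ beta); first by rewrite addr_ge0// divr_ge0// powR_ge0.
move=> s t s0 st tT; have w0 := control_ge0 cphi s0 st tT.
have [sth|hst] := leP (t - s) h.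
  apply: (le_trans (hh s t s0 st tT sth)); rewrite ler_wpM2r ?powR_ge0//.
  by rewrite lerDl divr_ge0// powR_ge0.
apply: (le_trans (FM s t s0 st tT)); apply: (le_trans (ler_norm M)).
have hb : 0 < h `^ beta by rewrite powR_gt0.
apply: (@le_trans _ _ (`|M| / h `^ beta * (phi t - phi s) `^ beta)).
  rewrite -mulrA ler_peMr// mulrC ler_pdivlMr// mul1r.
  apply: ge0_ler_powR; rewrite ?nnegrE ?(ltW b0) ?(ltW h0)//.
  by apply: le_trans (ltW hst) _; exact: cphi.
by rewrite ler_wpM2r ?powR_ge0// lerDr.
Qed.

Lemma small_unif0 phi beta F : is_control phi -> 0 <= beta -> small phi beta F -> unif0 F.
Proof.
move=> cphi b0 Fs e e0.
pose W := (phi T - phi 0) `^ beta + 1.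
have W0 : 0 < W by rewrite ltr_wpDl ?powR_ge0.
have [h h0 hh] := Fs (e / W) (divr_gt0 e0 W0).
exists h => // s t s0 st tT sth; apply: (le_trans (hh s t s0 st tT sth)).
rewrite mulrAC ler_pdivrMr// ler_wpM2l ?(ltW e0)//.
apply: (@le_trans _ _ ((phi T - phi 0) `^ beta)); last by rewrite /W lerDl.
exact: powR_subadd.
Qed.

(** The compactness of [0, T] makes the local bounds near the diagonal uniform. *)
Lemma local_unif0 F :
  (forall x : R, 0 <= x <= T -> forall e : R, 0 < e -> exists2 d : R, 0 < d &
     forall s t : R, 0 <= s <= T -> 0 <= t <= T ->
       `|s - x| <= d -> `|t - x| <= d -> `|F s t| <= e) ->
  unif0 F.
Proof.
move=> loc e e0.
have /compact_near_coveringP cpt := @segment_compact R 0 T.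
have := cpt R (0^'+) (fun h s => 0 <= s <= T -> forall t, 0 <= t <= T ->
   `|t - s| <= h -> `|F s t| <= e) _.
case.
  move=> x /=; rewrite in_itv /= => x0T.
  have [d d0 hd] := loc x x0T e e0.
  exists (ball x (d / 2), [set h : R | h < d / 2]) => /=.
    split; first by apply: nbhsx_ballx; rewrite divr_gt0.
    by apply: nbhs_right_lt; rewrite divr_gt0.
  move=> [s h] /= [sx hd2] s0T t t0T tsh.
  have sx2 : `|s - x| <= d / 2 by rewrite distrC ltW.
  apply: hd => //; first lra.
  have := ler_distD s t x; lra.
move=> h /= h0 hh.
exists (h / 2); first by rewrite divr_gt0.
move=> s t s0 st tT sth.
apply: (hh (h / 2) _ _ s).
- by rewrite /= sub0r normrN gtr0_norm ?divr_gt0//; lra.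
- by rewrite divr_gt0.
- by rewrite /= in_itv /= s0 (le_trans st).
- by rewrite s0 (le_trans st).
- by rewrite tT (le_trans s0).
- by rewrite ger0_norm// subr_ge0.
Qed.

End controls.

Section small_algebra.
Context {R : realType} (T : R) (phi : R -> R).
Hypothesis cphi : is_control T phi.
Implicit Types (E G : normedModType R) (alpha beta : R).

Lemma small_le {E G : normedModType R} alpha (F : R -> R -> E) (H : R -> R -> G) K :
  (forall s t : R, 0 <= s -> s <= t -> t <= T -> `|F s t| <= K * `|H s t|) ->
  small T phi alpha H -> small T phi alpha F.
Proof.
move=> FH Hs e e0; have K0 : 0 < `|K| + 1 by rewrite ltr_wpDl.
have [h h0 hh] := Hs (e / (`|K| + 1)) (divr_gt0 e0 K0).
exists h => // s t s0 st tT sth; apply: (le_trans (FH s t s0 st tT)).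
apply: (@le_trans _ _ ((`|K| + 1) * `|H s t|)).
  by rewrite ler_wpM2r// (le_trans (ler_norm K))// lerDl.
have := ler_wpM2l (ltW K0) (hh s t s0 st tT sth).
by rewrite mulrA [(`|K| + 1) * (e / _)]mulrC divfK// gt_eqF.
Qed.

Lemma smallD {E : normedModType R} alpha (F H : R -> R -> E) :
  small T phi alpha F -> small T phi alpha H ->
  small T phi alpha (fun s t => F s t + H s t).
Proof.
move=> Fs Hs e e0; have e20 : 0 < e / 2 by rewrite divr_gt0.
have [h1 h10 hh1] := Fs _ e20; have [h2 h20 hh2] := Hs _ e20.
exists (Num.min h1 h2); first by rewrite lt_min h10.
move=> s t s0 st tT; rewrite le_min => /andP[d1 d2].
apply: (le_trans (ler_normD _ _)).
have := hh1 s t s0 st tT d1; have := hh2 s t s0 st tT d2; lra.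
Qed.

Lemma smallN {E : normedModType R} alpha (F : R -> R -> E) :
  small T phi alpha F -> small T phi alpha (fun s t => - F s t).
Proof. by apply: (small_le (K := 1)) => *; rewrite normrN mul1r. Qed.

Lemma big_le {E G : normedModType R} beta (F : R -> R -> E) (H : R -> R -> G) K :
  (forall s t : R, 0 <= s -> s <= t -> t <= T -> `|F s t| <= K * `|H s t|) ->
  big T phi beta H -> big T phi beta F.
Proof.
move=> FH [M M0 HM]; exists (`|K| * M) => [|s t s0 st tT]; first by rewrite mulr_ge0.
apply: (le_trans (FH s t s0 st tT)).
apply: (@le_trans _ _ (`|K| * `|H s t|)); first by rewrite ler_wpM2r// ler_norm.
by rewrite -mulrA ler_wpM2l// HM.
Qed.

Lemma bigD {E : normedModType R} beta (F H : R -> R -> E) :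
  big T phi beta F -> big T phi beta H -> big T phi beta (fun s t => F s t + H s t).
Proof.
move=> [K K0 FK] [M M0 HM]; exists (K + M) => [|s t s0 st tT]; first by rewrite addr_ge0.
apply: (le_trans (ler_normD _ _)); rewrite mulrDl; apply: lerD; [exact: FK|exact: HM].
Qed.

Lemma big_bounded {E : normedModType R} beta (F : R -> R -> E) : 0 <= beta ->
  big T phi beta F ->
  exists M : R, forall s t : R, 0 <= s -> s <= t -> t <= T -> `|F s t| <= M.
Proof.
move=> b0 [M M0 FM]; exists (M * (phi T - phi 0) `^ beta) => s t s0 st tT.
apply: (le_trans (FM s t s0 st tT)); rewrite ler_wpM2l//.
exact: (powR_subadd cphi).
Qed.

Lemma small_mono (psi : R -> R) alpha {E : normedModType R} (F : R -> R -> E) :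
  0 <= alpha ->
  (forall s t : R, 0 <= s -> s < t -> t <= T -> phi t - phi s <= psi t - psi s) ->
  small T phi alpha F -> small T psi alpha F.
Proof.
move=> a0 le Fs e e0; have [h h0 hh] := Fs e e0; exists h => // s t s0 st tT sth.
apply: (le_trans (hh s t s0 st tT sth)); rewrite ler_wpM2l ?(ltW e0)//.
have p0 := control_ge0 cphi s0 st tT.
have le' : phi t - phi s <= psi t - psi s.
  move: st; rewrite le_eqVlt => /predU1P[->|st]; first by rewrite !subrr.
  exact: le.
by apply: ge0_ler_powR => //; rewrite nnegrE//; exact: le_trans le'.
Qed.

(** A function of order at least one has small sums over fine partitions: the
    power [theta - 1] of the control is bounded, and the control itself
    telescopes. *)
Lemma small_sum_vanishes {E : normedModType R} (F : R -> R -> E) (theta : R) :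
  1 <= theta -> small T phi theta F ->
  forall e : R, 0 < e -> exists2 h : R, 0 < h & forall t pi, t <= T ->
    itv_partition 0 t pi -> mesh 0 pi < h ->
    `|\sum_(uv <- subintervals 0 pi) F uv.1 uv.2| <= e.
Proof.
move=> th1 Fs e e0.
pose W := (phi T - phi 0) `^ (theta - 1) * (phi T - phi 0) + 1.
have [T0|T0] := leP 0 T; last first.
  exists 1 => // t pi tT pp _.
  have := le_trans (itv_partition_le pp) tT; rewrite leNgt T0 => //.
have w0 : 0 <= phi T - phi 0 by exact: (control_ge0 cphi).
have W0 : 0 < W by rewrite ltr_wpDl// mulr_ge0// powR_ge0.
have [h h0 hh] := Fs (e / W) (divr_gt0 e0 W0).
exists h => // t pi tT pp pm.
pose c := e / W * (phi T - phi 0) `^ (theta - 1).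
have c0 : 0 <= c by rewrite mulr_ge0 ?powR_ge0// divr_ge0// ltW.
apply: (@le_trans _ _ (\sum_(uv <- subintervals 0 pi) (c * phi uv.2 - c * phi uv.1))).
  apply: (le_trans (ler_norm_sum _ _ _)).
  rewrite big_seq [leRHS]big_seq; apply: ler_sum => uv uvp.
  have [u0 uv12 vt uvm] := subintervals_mem pp uvp.
  have vT := le_trans vt tT.
  apply: (le_trans (hh _ _ u0 (ltW uv12) vT (le_trans uvm (ltW pm)))).
  have -> : c * phi uv.2 - c * phi uv.1 =
      e / W * ((phi T - phi 0) `^ (theta - 1) * (phi uv.2 - phi uv.1)).
    by rewrite /c; ring.
  have eW : 0 <= e / W by rewrite divr_ge0// ltW.
  rewrite ler_wpM2l//.
  have uv0 : 0 <= phi uv.2 - phi uv.1 by apply: (control_ge0 cphi) => //; exact: ltW.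
  have th0 : 0 < theta by lra.
  rewrite -(mulr_powRB1 uv0 th0) mulrC ler_wpM2r//.
  by apply: (powR_subadd cphi) => //; [rewrite subr_ge0|exact: ltW].
rewrite (sum_subintervals_telescope (fun x => c * phi x) pp) -mulrBr.
apply: (@le_trans _ _ (c * (phi T - phi 0))).
  rewrite ler_wpM2l//; apply: (control_sub cphi) => //.
  exact: itv_partition_le pp.
rewrite /c -mulrA mulrAC ler_pdivrMr// ler_wpM2l ?(ltW e0)//.
by rewrite /W lerDl.
Qed.

End small_algebra.

(** * Continuous paths on a compact interval *)

Section continuity.
Context {R : realType} (T : R).

Lemma within_cont_ball {E : normedModType R} (X : R -> E) :
  {within `[0, T], continuous X} ->
  forall x : R, 0 <= x <= T -> forall e : R, 0 < e -> exists2 d : R, 0 < d &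
    forall s : R, 0 <= s <= T -> `|s - x| <= d -> `|X s - X x| <= e.
Proof.
move=> /subspace_continuousP Xc x x0T e e0.
have /Xc/cvgrPdist_le/(_ e e0) : `[0, T]%classic x by rewrite /= in_itv.
rewrite /prop_near1 /within /= => /nbhs_ballP[d /= d0 hd].
exists (d / 2); first by rewrite divr_gt0.
move=> s s0T sx; rewrite distrC; apply: (hd s) => /=; last by rewrite in_itv.
by rewrite /ball /= distrC; move: sx d0; lra.
Qed.

Lemma continuous_unif0 {E : normedModType R} (X : R -> E) :
  {within `[0, T], continuous X} -> unif0 T (increment X).
Proof.
move=> Xc; apply: local_unif0 => x x0T e e0.
have e20 : 0 < e / 2 by rewrite divr_gt0.
have [d d0 hd] := within_cont_ball Xc x0T e20.
exists d => // s t s0T t0T sx tx.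
have := hd s s0T sx; have := hd t t0T tx.
have := ler_distD (X x) (X t) (X s).
rewrite (distrC (X x) (X s)) /increment; lra.
Qed.

Lemma unif0_continuous {E : normedModType R} (X : R -> E) :
  unif0 T (increment X) -> {within `[0, T], continuous X}.
Proof.
move=> Xu; apply/subspace_continuousP => x /=; rewrite in_itv /= => /andP[x0 xT].
apply/cvgrPdist_le => e e0; have [h h0 hh] := Xu e e0.
rewrite /prop_near1 /within /=; apply/nbhs_ballP; exists h => // s /=.
rewrite /ball /= in_itv /= => xs /andP[s0 sT].
have [sx|xs'] := leP s x.
  by apply: hh => //; apply: le_trans (ltW xs); exact: ler_norm.
rewrite distrC; apply: hh => //; first exact: ltW.
by apply: le_trans (ltW xs); rewrite distrC; exact: ler_norm.
Qed.

Lemma continuous_norm_bounded {E : normedModType R} (X : R -> E) :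
  {within `[0, T], continuous X} ->
  exists2 M, 0 <= M & forall t : R, 0 <= t <= T -> `|X t| <= M.
Proof.
move=> Xc; have := continuous_compact Xc (@segment_compact _ 0 T).
move=> /compact_bounded[M [Mr hM]].
exists (`|M| + 1) => [|t t0T]; first by rewrite addr_ge0.
apply: (hM (`|M| + 1)); first by rewrite (le_lt_trans (ler_norm M))// ltrDl.
by exists t => //=; rewrite in_itv.
Qed.

Lemma continuous2_unif0 {E : normedModType R} (F : R -> R -> E) :
  {within `[0, T] `*` `[0, T], continuous (fun st : R * R => F st.1 st.2)} ->
  (forall s : R, 0 <= s <= T -> F s s = 0) -> unif0 T F.
Proof.
move=> /subspace_continuousP Fc F0; apply: local_unif0 => x x0T e e0.
have /Fc/cvgrPdist_le/(_ e e0) : (`[0, T]%classic `*` `[0, T]%classic) (x, x).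
  by rewrite /= in_itv.
rewrite /prop_near1 /within /= => /nbhs_ballP[d /= d0]; rewrite /from_subspace /= F0// => hd.
exists (d / 2); first by rewrite divr_gt0.
move=> s t s0T t0T sx tx; rewrite -normrN -sub0r.
apply: (hd (s, t)); last by rewrite /= !in_itv.
by split; rewrite /ball /= distrC; [move: sx d0|move: tx d0]; lra.
Qed.

End continuity.

(** * Sewing *)

(** Arithmetic on indices, with the inequalities between reals removed from the
    context. *)
Ltac nlia := repeat match goal with
  | H : is_true (@Order.le _ _ _ _) |- _ => clear H
  | H : is_true (@Order.lt _ _ _ _) |- _ => clear H
  | H : forall x, _ |- _ => clear H end; lia.

(** The last index before half of the control is spent.  The interval [k, k.+1],
    which may carry almost all of the control, belongs to neither half. *)
Lemma halving_index {R : realType} (c : nat -> R) (n i j : nat) :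
  (forall k l, (k <= l <= n)%N -> c k <= c l) -> (i < j <= n)%N ->
  exists k, [/\ (i <= k < j)%N, c k - c i <= (c j - c i) / 2
              & c j - c k.+1 <= (c j - c i) / 2].
Proof.
move=> cmon /andP[ij jn].
have [l] : exists l, (j - i = l.+1)%N by exists (j - i).-1; nlia.
move=> jil; have -> : j = (i + l.+1)%N by nlia.
have {jil ij jn} : (i + l.+1 <= n)%N by nlia.
move=> iln.
pose P k := (k <= l)%N && (c (i + k)%N - c i <= (c (i + l.+1)%N - c i) / 2).
have P0 : P 0%N.
  by rewrite /P leq0n addn0 subrr; rewrite divr_ge0// subr_ge0 cmon//; nlia.
have Pb k : P k -> (k <= l)%N by case/andP.
have [k /andP[kl ck] kmax] := ex_maxnP (ex_intro _ 0%N P0) Pb.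
exists (i + k)%N; split => //; first nlia.
have [kl'|kl'] := eqVneq k l.
  by subst k; rewrite -addnS subrr divr_ge0// subr_ge0 cmon//; nlia.
have /negP : ~ P k.+1 by move=> /kmax; rewrite ltnn.
rewrite /P negb_and -ltnNge => /orP[kl1|]; first nlia.
rewrite -ltNge !addnS => ?; lra.
Qed.

(** The maps [m i j] are almost multiplicative, with a defect of order
    [theta > 1] in the additive control [c], and [y] follows the maps [m k k.+1]
    up to an error of the same order; then [y j] is within the same order of
    [m i j (y i)], with a constant independent of the number of steps.  By
    induction on [j - i]: splitting at [halving_index] produces two chains with
    at most half of the control, so their errors shrink by the factor
    [2 `^ theta > 2], which absorbs the two occurrences of the induction
    hypothesis as well as the Lipschitz constants.

    The size [N] serves as a weight: the errors are proportional to the size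
    of the point where the chain starts. *)
Lemma discrete_sewing {R : realType} {E : normedModType R}
    (m : nat -> nat -> E -> E) (N : E -> R) (c : nat -> R) (y : nat -> E)
    (n : nat) (eta eps K theta : R) :
  0 <= eta -> 0 <= eps -> eps <= K -> 0 < theta ->
  2 * (1 + 2 * eta) ^+ 2 * K + 3 * (1 + 2 * eta) ^+ 2 * 2 `^ theta * eps
    <= 2 `^ theta * K ->
  K * (c n - c 0%N) `^ theta <= eta ->
  (forall i j, (i <= j <= n)%N -> c i <= c j) ->
  (forall x, 0 <= N x) ->
  (forall x x', N x <= N x' + `|x - x'|) ->
  (forall i x, m i i x = x) ->
  (forall i j x, (i <= j <= n)%N -> N (m i j x) <= (1 + eta) * N x) ->
  (forall i j x x', (i <= j <= n)%N ->
     `|m i j x - m i j x'| <= (1 + eta) * `|x - x'|) ->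
  (forall i k j x, (i <= k <= j)%N -> (j <= n)%N ->
     `|m k j (m i k x) - m i j x| <= eps * (c j - c i) `^ theta * N x) ->
  (forall k, (k < n)%N ->
     `|y k.+1 - m k k.+1 (y k)| <= eps * (c k.+1 - c k) `^ theta * N (y k)) ->
  forall i j, (i <= j <= n)%N ->
    `|y j - m i j (y i)| <= K * (c j - c i) `^ theta * N (y i).
Proof.
move=> eta0 eps0 epsK th0 hK hKw cmon N0 NT m1 Nm lip defect step i j.
have K0 : 0 <= K by exact: le_trans epsK.
have [l] := ubnP (j - i); elim: l i j => // l IH i j jil ijn.
have [ij|ij] := eqVneq i j.
  by rewrite ij m1 !subrr normr0 powR0 ?gt_eqF// mulr0 mul0r.
have [k [ikj hk1 hk2]] := @halving_index R c n i j cmon ltac:(nlia).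
set w := c j - c i.
have cij : c i <= c j by exact: cmon.
have w0 : 0 <= w by rewrite subr_ge0.
have hw a b : (i <= a <= b)%N -> (b <= j)%N -> (c b - c a) `^ theta <= w `^ theta.
  move=> iab bj; have ca : c i <= c a by apply: cmon; nlia.
  have cb : c b <= c j by apply: cmon; nlia.
  have cab : c a <= c b by apply: cmon; nlia.
  by apply: ge0_ler_powR; rewrite ?nnegrE ?subr_ge0 ?(ltW th0)// /w lerB.
have hhalf a b : (a <= b <= n)%N -> c b - c a <= w / 2 ->
    (c b - c a) `^ theta <= w `^ theta / 2 `^ theta.
  move=> abn h.
  have -> : w `^ theta / 2 `^ theta = (w / 2) `^ theta.
    have {1}-> : w = (w / 2) * 2 by rewrite divfK.
    by rewrite powRM// ?divr_ge0// mulfK// gt_eqF// powR_gt0.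
  have cab : c a <= c b by exact: cmon.
  by apply: ge0_ler_powR; rewrite ?nnegrE ?subr_ge0 ?(ltW th0) ?divr_ge0.
set W := w `^ theta.
have W0 : 0 <= W by exact: powR_ge0.
have KW : K * W <= eta.
  have ci : c 0%N <= c i by apply: cmon; nlia.
  have cj : c j <= c n by apply: cmon; nlia.
  have c0n : c 0%N <= c n by apply: cmon; nlia.
  apply: le_trans hKw; rewrite ler_wpM2l// ge0_ler_powR// ?nnegrE ?subr_ge0 ?(ltW th0) ?lerB//.
pose Z := 2 `^ theta : R.
have Z0 : 0 < Z by rewrite powR_gt0.
have epsW : eps * W <= eta by apply: le_trans KW; rewrite ler_wpM2r.
have Ni := N0 (y i).
have Pik := IH i k ltac:(nlia) ltac:(nlia).
have Pkj := IH k.+1 j ltac:(nlia) ltac:(nlia).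
have Pk := step k ltac:(nlia).
have {}Pik : `|y k - m i k (y i)| <= K * (W / Z) * N (y i).
  apply: (le_trans Pik); rewrite ler_wpM2r// ler_wpM2l// hhalf//; nlia.
have Z1 : 1 <= Z 
  by have := @ler_powR _ 2 ltac:(by rewrite ler1n) _ _ (ltW th0); rewrite powRr0.
have WZ : W / Z <= W by rewrite ler_pdivrMr// ler_peMr.
have Nk : N (y k) <= (1 + 2 * eta) * N (y i).
  apply: (le_trans (NT _ (m i k (y i)))).
  have := Nm i k (y i) ltac:(nlia).
  have : K * (W / Z) * N (y i) <= eta * N (y i).
    by rewrite ler_wpM2r// (le_trans _ KW)// ler_wpM2l.
  lra.
have Nk0 := N0 (y k).
have {}Pk : `|y k.+1 - m k k.+1 (y k)| <= eps * W * N (y k).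
  apply: (le_trans Pk); rewrite ler_wpM2r// ler_wpM2l// hw//; nlia.
have Nk1 : N (y k.+1) <= (1 + 2 * eta) * N (y k).
  apply: (le_trans (NT _ (m k k.+1 (y k)))).
  have := Nm k k.+1 (y k) ltac:(nlia).
  have : eps * W * N (y k) <= eta * N (y k) by rewrite ler_wpM2r.
  lra.
have {}Pkj : `|y j - m k.+1 j (y k.+1)| <= K * (W / Z) * N (y k.+1).
  apply: (le_trans Pkj); rewrite ler_wpM2r// ler_wpM2l// hhalf//; nlia.
(* replace the chain by m i k, m k k.+1 and m k.+1 j, one after the other *)
have -> : y j - m i j (y i) =
   (y j - m k.+1 j (y k.+1))
   + (m k.+1 j (y k.+1) - m k.+1 j (m k k.+1 (y k)))
   + (m k.+1 j (m k k.+1 (y k)) - m k j (y k))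
   + (m k j (y k) - m k j (m i k (y i)))
   + (m k j (m i k (y i)) - m i j (y i)) by rewrite !addrA !subrK.
have defect_const := defect k k.+1 j (y k) ltac:(nlia) ltac:(nlia).
have D2 := defect i k j (y i) ltac:(nlia) ltac:(nlia).
have {}defect_const : `|m k.+1 j (m k k.+1 (y k)) - m k j (y k)| <= eps * W * N (y k).
  apply: (le_trans defect_const); rewrite ler_wpM2r// ler_wpM2l// hw//; nlia.
have L1 := lip k.+1 j (y k.+1) (m k k.+1 (y k)) ltac:(nlia).
have L2 := lip k j (y k) (m i k (y i)) ltac:(nlia).
have e1 : 0 <= eps * W by rewrite mulr_ge0.
have k1 : 0 <= K * (W / Z) by rewrite mulr_ge0 ?divr_ge0// ltW.
set b := (1 + 2 * eta) ^+ 2 in hK *.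
have B1 : `|y j - m k.+1 j (y k.+1)| <= K * (W / Z) * (b * N (y i)).
  apply: (le_trans Pkj); rewrite ler_wpM2l// (le_trans Nk1)//.
  rewrite /b expr2 -mulrA ler_wpM2l//; lra.
have B2 : `|m k.+1 j (y k.+1) - m k.+1 j (m k k.+1 (y k))| <= eps * W * (b * N (y i)).
  apply: (le_trans L1).
  have -> : eps * W * (b * N (y i)) = (1 + 2 * eta) * (eps * W * ((1 + 2 * eta) * N (y i))).
    by rewrite /b; ring.
  apply: ler_pM => //; first lra; first lra.
  by apply: (le_trans Pk); rewrite ler_wpM2l.
have bN : (1 + 2 * eta) * N (y i) <= b * N (y i).
  rewrite ler_wpM2r// /b expr2 ler_peMr; lra.
have B3 : `|m k.+1 j (m k k.+1 (y k)) - m k j (y k)| <= eps * W * (b * N (y i)).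
  by apply: (le_trans defect_const); rewrite ler_wpM2l// (le_trans Nk).
have B4 : `|m k j (y k) - m k j (m i k (y i))| <= K * (W / Z) * (b * N (y i)).
  apply: (le_trans L2); rewrite (le_trans (ler_wpM2l _ Pik))//; first lra.
  rewrite mulrCA ler_wpM2l// (le_trans _ bN)// ler_wpM2r//; lra.
have B5 : `|m k j (m i k (y i)) - m i j (y i)| <= eps * W * (b * N (y i)).
  apply: (le_trans D2); rewrite ler_wpM2l// (le_trans _ bN)// ler_peMl//; lra.
apply: (@le_trans _ _ ((2 * b * (K * (W / Z)) + 3 * b * (eps * W)) * N (y i))).
  rewrite (le_trans (ler_normD _ _))// (le_trans (lerD (ler_normD _ _) B5))//.
  rewrite (le_trans (lerD (lerD (ler_normD _ _) B4) (lexx _)))//.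
  rewrite (le_trans (lerD (lerD (lerD (ler_normD _ _) B3) (lexx _)) (lexx _)))//.
  by lra.
rewrite ler_wpM2r//.
have -> : 2 * b * (K * (W / Z)) + 3 * b * (eps * W) =
  (2 * b * K + 3 * b * Z * eps) * (W / Z) by field; rewrite gt_eqF.
have -> : K * W = (Z * K) * (W / Z) by field; rewrite gt_eqF.
by rewrite ler_wpM2r// divr_ge0// ltW.
Qed.

Section sewing.
Context {R : realType}.

(** The inequality required by [discrete_sewing] for [K = kappa * eps] has a
    solution because [2 `^ theta > 2]: for [eta = 0] it reads
    [2 * K + 3 * 2 `^ theta * eps <= 2 `^ theta * K]. *)
Lemma sewing_constants (theta : R) : 1 < theta ->
  exists eta kappa : R, [/\ 0 < eta, eta <= 1 / 2, 1 <= kappa & forall eps : R, 0 <= eps ->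
    2 * (1 + 2 * eta) ^+ 2 * (kappa * eps)
      + 3 * (1 + 2 * eta) ^+ 2 * 2 `^ theta * eps <= 2 `^ theta * (kappa * eps)].
Proof.
move=> th1; pose Z := 2 `^ theta : R.
have Z2 : 2 < Z.
  rewrite /Z; have {1}-> : (2 : R) = 2 `^ 1 by rewrite powRr1.
  by rewrite /powR pnatr_eq0 /= ltr_expR ltr_pM2r// ln_gt0// ltr1n.
(* eta makes 2 * (1 + 2 * eta) ^+ 2 at most the midpoint of 2 and Z *)
exists ((Z - 2) / (32 * Z)), (3 * Z * (Z + 2) / (2 * (Z - 2))).
have Z20 : 0 < Z - 2 by rewrite subr_gt0.
set eta := (Z - 2) / _; set kappa := 3 * Z * (Z + 2) / _.
have Z0 : 0 < Z by lra.
have eta0 : 0 < eta by rewrite divr_gt0// mulr_gt0.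
have eta1 : eta <= 1.
  by rewrite ler_pdivrMr ?mulr_gt0//; lra.
have b1 : 2 * (1 + 2 * eta) ^+ 2 <= (Z + 2) / 2.
  have h : eta <= (Z - 2) / 32.
    rewrite /eta invfM mulrA ler_pdivrMr// ler_peMr//; last lra.
    by rewrite divr_ge0// ltW.
  by have := ltW eta0; nra.
have k1 : kappa * (2 * (Z - 2)) = 3 * Z * (Z + 2).
  by rewrite /kappa divfK// mulf_neq0 ?pnatr_eq0// gt_eqF.
split => //.
    by rewrite /eta ler_pdivrMr ?mulr_gt0//; lra.
  by rewrite ler_pdivlMr ?mulr_gt0//; nra.
have k0 : 0 <= kappa by rewrite divr_ge0 ?mulr_ge0//; lra.
move=> eps eps0.
rewrite -/Z; set b := (1 + 2 * eta) ^+ 2 in b1 *.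
have : 2 * b * kappa + 3 * b * Z <= Z * kappa.
  have : 2 * b * kappa <= (Z + 2) / 2 * kappa by rewrite ler_wpM2r.
  have : 3 * Z * (2 * b) <= 3 * Z * ((Z + 2) / 2) by rewrite ler_wpM2l//; lra.
  move: k1; lra.
move=> /(ler_wpM2r eps0); lra.
Qed.

(** [discrete_sewing] for maps indexed by times, evaluated along a nondecreasing
    sequence of times in a window [a, b]. *)
Lemma sewing_on {E : normedModType R} (mu : R -> R -> E -> E) (N : E -> R)
    (phi : R -> R) (T a b eta eps K theta : R) (u : nat -> R) (y : nat -> E) n :
  is_control T phi -> 0 <= a -> b <= T -> 0 < theta ->
  0 <= eta -> 0 <= eps -> eps <= K ->
  2 * (1 + 2 * eta) ^+ 2 * K + 3 * (1 + 2 * eta) ^+ 2 * 2 `^ theta * eps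
    <= 2 `^ theta * K ->
  K * (phi T - phi 0) `^ theta <= eta ->
  (forall x, 0 <= N x) ->
  (forall x x', N x <= N x' + `|x - x'|) ->
  (forall s x, a <= s <= b -> mu s s x = x) ->
  (forall s t x, a <= s -> s <= t -> t <= b -> N (mu s t x) <= (1 + eta) * N x) ->
  (forall s t x x', a <= s -> s <= t -> t <= b ->
     `|mu s t x - mu s t x'| <= (1 + eta) * `|x - x'|) ->
  (forall s r t x, a <= s -> s <= r -> r <= t -> t <= b ->
     `|mu r t (mu s r x) - mu s t x| <= eps * (phi t - phi s) `^ theta * N x) ->
  (forall i j, (i <= j <= n)%N -> u i <= u j) -> a <= u 0%N -> u n <= b ->
  (forall k, (k < n)%N -> `|y k.+1 - mu (u k) (u k.+1) (y k)| <=
      eps * (phi (u k.+1) - phi (u k)) `^ theta * N (y k)) ->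
  `|y n - mu (u 0%N) (u n) (y 0%N)| <=
     K * (phi (u n) - phi (u 0%N)) `^ theta * N (y 0%N).
Proof.
move=> cphi a0 bT th0 eta0 eps0 epsK hK hKw N0 NT m1 Nm lip defect umon au ub step.
(* past n the sequence is frozen: the diagonal axiom is asked for all indices *)
pose clip i := minn i n.
have clipn i : (i <= n)%N -> clip i = i by move=> h; rewrite /clip (minn_idPl h).
have K0 : 0 <= K by exact: le_trans epsK.
have uab i : (i <= n)%N -> a <= u i <= b.
  move=> iin; apply/andP; split.
    by apply: le_trans au _; apply: umon.
  by apply: le_trans ub; apply: umon; rewrite iin leqnn.
have cmon i j : (i <= j <= n)%N -> phi (u i) <= phi (u j).
  move=> /andP[ij jn]; rewrite -subr_ge0.
  have /andP[ai _] := uab i (leq_trans ij jn).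
  have /andP[_ jb] := uab j jn.
  apply: (control_ge0 cphi (le_trans a0 ai) _ (le_trans jb bT)).
  by apply: umon; rewrite ij.
have hKw' : K * (phi (u n) - phi (u 0%N)) `^ theta <= eta.
  apply: le_trans hKw; rewrite ler_wpM2l//; apply: (powR_subadd cphi) => //.
  - exact: ltW.
  - exact: le_trans au.
  - by apply: umon; rewrite leqnn.
  - exact: le_trans bT.
have key : `|y n - mu (u (clip 0%N)) (u (clip n)) (y 0%N)| <=
     K * (phi (u n) - phi (u 0%N)) `^ theta * N (y 0%N); last first.
  by move: key; rewrite !clipn.
apply: (@discrete_sewing R E (fun i j => mu (u (clip i)) (u (clip j))) N (fun i => phi (u i)) y n
  eta eps K theta) => //; last by rewrite leqnn.
- by move=> i x; apply: m1; apply: uab; rewrite geq_minr.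
- move=> i j x /andP[ij jn]; rewrite !clipn ?(leq_trans ij)//.
  have /andP[ai _] := uab i (leq_trans ij jn).
  have /andP[_ jb] := uab j jn.
  by apply: Nm => //; apply: umon; rewrite ij.
- move=> i j x x' /andP[ij jn]; rewrite !clipn ?(leq_trans ij)//.
  have /andP[ai _] := uab i (leq_trans ij jn).
  have /andP[_ jb] := uab j jn.
  by apply: lip => //; apply: umon; rewrite ij.
- move=> i k j x /andP[ik kj] jn; rewrite !clipn ?(leq_trans kj)// ?(leq_trans ik)// ?(leq_trans kj)//.
  have /andP[ai _] := uab i (leq_trans ik (leq_trans kj jn)).
  have /andP[_ jb] := uab j jn.
  apply: defect => //; apply: umon; rewrite ?ik ?kj//=.
  exact: leq_trans jn.
- by move=> k kn; rewrite !clipn//; [exact: step|exact: ltnW].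
Qed.

(** The sums of [Xi] are the orbits of the translations [x + Xi s t], to which
    [sewing_on] applies with the constant size 1. *)
Lemma additive_sewing {E : normedModType R} (Xi : R -> R -> E) (phi : R -> R)
    (T theta : R) : is_control T phi -> 1 < theta ->
  (forall s, 0 <= s <= T -> Xi s s = 0) ->
  (forall e, 0 < e -> exists2 h, 0 < h & forall s r t, 0 <= s -> s <= r ->
     r <= t -> t <= T -> t - s <= h ->
     `|Xi s r + Xi r t - Xi s t| <= e * (phi t - phi s) `^ theta) ->
  forall e, 0 < e -> exists2 h, 0 < h & forall s t pi, 0 <= s -> t <= T ->
    t - s <= h -> itv_partition s t pi ->
    `|\sum_(uv <- subintervals s pi) Xi uv.1 uv.2 - Xi s t|
       <= e * (phi t - phi s) `^ theta.
Proof.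
move=> cphi th1 Xi0 hXi e e0.
have [eta [kappa [eta0 _ kappa1 hk]]] := sewing_constants th1.
have th0 : 0 < theta by lra.
pose W := (phi T - phi 0) `^ theta + 1.
have W0 : 0 < W by rewrite ltr_wpDl ?powR_ge0.
pose e' := Num.min e (eta / W) / kappa.
have kappa0 : 0 < kappa by lra.
have e'0 : 0 < e' by rewrite divr_gt0// lt_min e0 divr_gt0.
have [h h0 hh] := hXi e' e'0.
exists h => // s t pi s0 tT sth sp.
have st := itv_partition_le sp.
pose u k := nth s (s :: pi) k.
pose y k := \sum_(i < k) Xi (u i) (u i.+1).
have un : u (size pi) = t by case: sp => _ /eqP <-; rewrite /u -last_nth.
have usort i j : (i <= j <= size pi)%N -> u i <= u j.
  move=> /andP[ij jn]; apply: (sorted_leq_nth le_trans le_refl) => //.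
  - by case: sp => /= + _; apply: sub_path => ? ?; exact: ltW.
  - by rewrite inE /= ltnS (leq_trans ij).
have key := @sewing_on E (fun s t x => x + Xi s t) (fun=> 1) phi T s t eta e' (kappa * e')
  theta u y (size pi) cphi s0 tT th0 (ltW eta0) (ltW e'0).
have ke : kappa * e' = Num.min e (eta / W) by rewrite /e' mulrC divfK// gt_eqF.
rewrite sum_subintervals.
have -> : \sum_(i < size pi) Xi (nth s (s :: pi) i) (nth s (s :: pi) i.+1) - Xi s t =
   y (size pi) - (y 0%N + Xi (u 0%N) (u (size pi))).
  by rewrite un /y big_ord0 add0r.
have -> : phi t - phi s = phi (u (size pi)) - phi (u 0%N) by rewrite un.
apply: (@le_trans _ _ (kappa * e' * (phi (u (size pi)) - phi (u 0)) `^ theta * 1)).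
  apply: key => //.
  - by rewrite ler_peMl// ltW.
  - exact: hk (ltW e'0).
  - rewrite ke; apply: (@le_trans _ _ (eta / W * (phi T - phi 0) `^ theta)).
      by rewrite ler_wpM2r ?powR_ge0// ge_min lexx orbT.
    rewrite mulrAC ler_pdivrMr// ler_wpM2l ?(ltW eta0)//.
    by rewrite /W lerDl.
  - by move=> *; rewrite lerDl.
  - move=> r x /andP[sr rt]; rewrite Xi0 ?addr0// (le_trans s0 sr)/=.
    exact: le_trans rt tT.
  - by move=> *; rewrite mulr1 lerDl ltW.
  - move=> a b x x' sa ab bt; rewrite opprD addrACA subrr addr0 ler_peMl//.
    by rewrite lerDl ltW.
  - move=> a b c x sa ab bc ct.
    rewrite mulr1 -(addrA x) opprD (addrACA x) subrr add0r.
    apply: hh => //; [exact: le_trans sa|exact: le_trans tT|].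
    by apply: le_trans sth; rewrite lerB.
  - by rewrite un.
  - move=> k kn; rewrite /y big_ord_recr /= subrr normr0 mulr_ge0// mulr_ge0 ?powR_ge0//.
    exact: ltW.
rewrite mulr1 ke ler_wpM2r ?powR_ge0//.
by rewrite ge_min lexx.
Qed.

End sewing.

(** * The second-order germ *)

Section matrix_bounds.
Context {R : realType}.

Lemma mx_entry_le {m k} (M : 'M[R]_(m, k)) i j : `|M i j| <= `|M|.
Proof.
rewrite [leRHS]/Num.norm /= mx_normrE.
by apply: (le_bigmax _ (fun ij : 'I_m * 'I_k => `|M ij.1 ij.2|) (i, j)).
Qed.

Lemma mx_norm_le {m k} (M : 'M[R]_(m, k)) (c : R) :
  0 <= c -> (forall i j, `|M i j| <= c) -> `|M| <= c.
Proof.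
move=> c0 h; rewrite [leLHS]/Num.norm /= mx_normrE.
by apply/bigmax_leP; split => // -[i j] _ /=.
Qed.

Lemma norm_sum_ord {k} (f : 'I_k -> R) (c : R) :
  (forall i, `|f i| <= c) -> `|\sum_i f i| <= k%:R * c.
Proof.
move=> h; apply: (le_trans (ler_norm_sum _ _ _)).
apply: (le_trans (ler_sum _ (fun i _ => h i))).
by rewrite sumr_const card_ord mulr_natl.
Qed.

Lemma norm_col_le {m k} (M : 'M[R]_(m, k)) j : `|col j M| <= `|M|.
Proof. by apply: mx_norm_le => // i l; rewrite mxE; exact: mx_entry_le. Qed.

Lemma mx_addE {m k} (A B : 'M[R]_(m, k)) i j : (A + B) i j = A i j + B i j.
Proof. by rewrite mxE. Qed.

Lemma mx_oppE {m k} (A : 'M[R]_(m, k)) i j : (- A) i j = - A i j.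
Proof. by rewrite mxE. Qed.

End matrix_bounds.

Section germ.
Context {R : realType} {n d : nat}.
Implicit Types (S U : 'cV[R]_(n * d * n)) (Sd Ud : 'M[R]_(n * d * n, d)).
Implicit Types (w x y : 'cV[R]_n) (wd : 'M[R]_(n, d)) (a b : 'cV[R]_d).

(** One constant that bounds all the bilinear operations below; matrices carry
    the maximum norm, which is not submultiplicative. *)
Definition bilin_const : R := n%:R + d%:R + d%:R * d%:R + 1.

Lemma bilin_const_ge1 : 1 <= bilin_const.
Proof. by rewrite /bilin_const lerDr !addr_ge0// mulr_ge0. Qed.

Lemma bilin_const_ge0 : 0 <= bilin_const. Proof. exact: le_trans bilin_const_ge1. Qed.

Lemma tensor_mulDl S U w : tensor_mul (S + U) w = tensor_mul S w + tensor_mul U w.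
Proof.
apply/matrixP => i j; rewrite !mxE -big_split; apply: eq_bigr => k _ /=.
by rewrite mxE mulrDl.
Qed.

Lemma tensor_mulDr S w x : tensor_mul S (w + x) = tensor_mul S w + tensor_mul S x.
Proof.
apply/matrixP => i j; rewrite !mxE -big_split; apply: eq_bigr => k _ /=.
by rewrite mxE mulrDr.
Qed.

Lemma tensor_mulNl S w : tensor_mul (- S) w = - tensor_mul S w.
Proof.
apply/matrixP => i j; rewrite !mxE -sumrN; apply: eq_bigr => k _ /=.
by rewrite mxE mulNr.
Qed.

Lemma tensor_mulNr S w : tensor_mul S (- w) = - tensor_mul S w.
Proof.
apply/matrixP => i j; rewrite !mxE -sumrN; apply: eq_bigr => k _ /=.
by rewrite mxE mulrN.
Qed.

Lemma deriv_contractDl (B D : 'M[R]_(n * d, d)) (M : 'M[R]_d) :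
  deriv_contract (B + D) M = deriv_contract B M + deriv_contract D M.
Proof.
apply/matrixP => i j; rewrite !mxE -big_split; apply: eq_bigr => k _ /=.
by rewrite -big_split; apply: eq_bigr => l _ /=; rewrite mxE mulrDl.
Qed.

Lemma deriv_contractNl (B : 'M[R]_(n * d, d)) (M : 'M[R]_d) :
  deriv_contract (- B) M = - deriv_contract B M.
Proof.
apply/matrixP => i j; rewrite !mxE -sumrN; apply: eq_bigr => k _ /=.
by rewrite -sumrN; apply: eq_bigr => l _ /=; rewrite mxE mulNr.
Qed.

Lemma deriv_contractDr (B : 'M[R]_(n * d, d)) (M P : 'M[R]_d) :
  deriv_contract B (M + P) = deriv_contract B M + deriv_contract B P.
Proof.
apply/matrixP => i j; rewrite !mxE -big_split; apply: eq_bigr => k _ /=.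
by rewrite -big_split; apply: eq_bigr => l _ /=; rewrite mxE mulrDr.
Qed.

Lemma tensor_mul_derivE S Sd w wd i j l :
  tensor_mul_deriv S Sd w wd (mxvec_index i j) l =
  tensor_mul S (col l wd) i j + tensor_mul (col l Sd) w i j.
Proof. by rewrite mxE mxvecE mxE. Qed.

Lemma tensor_mul_derivD S Sd U Ud w wd :
  tensor_mul_deriv (S + U) (Sd + Ud) w wd =
  tensor_mul_deriv S Sd w wd + tensor_mul_deriv U Ud w wd.
Proof.
apply/matrixP => q l; case/mxvec_indexP: q => i j.
rewrite [in RHS]mxE !tensor_mul_derivE linearD /= !tensor_mulDl.
by rewrite !mx_addE; ring.
Qed.

Lemma tensor_mul_derivDr S Sd w wd x xd :
  tensor_mul_deriv S Sd (w + x) (wd + xd) =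
  tensor_mul_deriv S Sd w wd + tensor_mul_deriv S Sd x xd.
Proof.
apply/matrixP => q l; case/mxvec_indexP: q => i j.
rewrite [in RHS]mxE !tensor_mul_derivE linearD /= !tensor_mulDr.
by rewrite !mx_addE; ring.
Qed.

Lemma tensor_mul_derivN S Sd w wd :
  tensor_mul_deriv (- S) (- Sd) w wd = - tensor_mul_deriv S Sd w wd.
Proof.
apply/matrixP => q l; case/mxvec_indexP: q => i j.
by rewrite [in RHS]mxE !tensor_mul_derivE linearN /= !tensor_mulNl !mx_oppE opprD.
Qed.

Lemma tensor_mul_derivNr S Sd w wd :
  tensor_mul_deriv S Sd (- w) (- wd) = - tensor_mul_deriv S Sd w wd.
Proof.
apply/matrixP => q l; case/mxvec_indexP: q => i j.
by rewrite [in RHS]mxE !tensor_mul_derivE linearN /= !tensor_mulNr !mx_oppE opprD.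
Qed.

Lemma norm_mulmx_nd wd a : `|wd *m a| <= bilin_const * `|wd| * `|a|.
Proof.
apply: mx_norm_le => [|i j]; first by rewrite !mulr_ge0// bilin_const_ge0.
rewrite mxE; apply: (@le_trans _ _ (d%:R * (`|wd| * `|a|))).
  by apply: norm_sum_ord => k; rewrite normrM ler_pM// mx_entry_le.
rewrite -mulrA ler_wpM2r ?mulr_ge0// /bilin_const.
by rewrite -addrA (addrC n%:R) -!addrA lerDl !addr_ge0// mulr_ge0.
Qed.

Lemma norm_mulmx_nn (B : 'M[R]_n) x : `|B *m x| <= bilin_const * `|B| * `|x|.
Proof.
apply: mx_norm_le => [|i j]; first by rewrite !mulr_ge0// bilin_const_ge0.
rewrite mxE; apply: (@le_trans _ _ (n%:R * (`|B| * `|x|))).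
  by apply: norm_sum_ord => k; rewrite normrM ler_pM// mx_entry_le.
rewrite -mulrA ler_wpM2r ?mulr_ge0// /bilin_const.
by rewrite -!addrA lerDl !addr_ge0// mulr_ge0.
Qed.

Lemma norm_tensor_mul S w : `|tensor_mul S w| <= bilin_const * `|S| * `|w|.
Proof.
apply: mx_norm_le => [|i j]; first by rewrite !mulr_ge0// bilin_const_ge0.
rewrite mxE; apply: (@le_trans _ _ (n%:R * (`|S| * `|w|))).
  by apply: norm_sum_ord => k; rewrite normrM ler_pM// mx_entry_le.
rewrite -mulrA ler_wpM2r ?mulr_ge0// /bilin_const.
by rewrite -!addrA lerDl !addr_ge0// mulr_ge0.
Qed.

Lemma norm_deriv_contract (B : 'M[R]_(n * d, d)) (M : 'M[R]_d) :
  `|deriv_contract B M| <= bilin_const * `|B| * `|M|.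
Proof.
apply: mx_norm_le => [|i j]; first by rewrite !mulr_ge0// bilin_const_ge0.
rewrite mxE; apply: (@le_trans _ _ (d%:R * (d%:R * (`|B| * `|M|)))).
  apply: norm_sum_ord => k; apply: norm_sum_ord => l.
  by rewrite normrM ler_pM// mx_entry_le.
rewrite mulrA -mulrA mulrA -[leRHS]mulrA ler_wpM2r ?mulr_ge0// /bilin_const.
by rewrite -!addrA (addrC (d%:R * _)) !addrA lerDr !addr_ge0.
Qed.

Lemma norm_tensor_mul_deriv S Sd w wd :
  `|tensor_mul_deriv S Sd w wd| <= bilin_const * `|S| * `|wd| + bilin_const * `|Sd| * `|w|.
Proof.
have c0 := bilin_const_ge0.
apply: mx_norm_le => [|q l]; first by rewrite addr_ge0// !mulr_ge0.
case/mxvec_indexP: q => i j; rewrite tensor_mul_derivE.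
apply: (le_trans (ler_normD _ _)); apply: lerD.
  apply: (le_trans (mx_entry_le _ _ _)); apply: (le_trans (norm_tensor_mul _ _)).
  by rewrite ler_wpM2l ?mulr_ge0// norm_col_le.
apply: (le_trans (mx_entry_le _ _ _)); apply: (le_trans (norm_tensor_mul _ _)).
by rewrite ler_wpM2r// ler_wpM2l// norm_col_le.
Qed.

(** The index conventions of the Gubinelli derivative and of Chen's relation
    agree: pairing with [a (x) b] differentiates in the direction [a] and
    integrates against [b]. *)
Lemma deriv_contract_tensor S Sd w wd a b :
  deriv_contract (tensor_mul_deriv S Sd w wd) (a *m b^T) =
  (tensor_mul S (wd *m a) + tensor_mul (Sd *m a) w) *m b.
Proof.
apply/matrixP => i z; rewrite (ord1 z) !mxE; apply: eq_bigr => j _.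
under eq_bigr => l _ do rewrite tensor_mul_derivE !mxE big_ord1 !mxE mulrA.
rewrite -mulr_suml; congr (_ * _); rewrite !mxE.
under eq_bigr => l _ do rewrite mulrDl !mulr_suml.
rewrite big_split /=; congr (_ + _); rewrite exchange_big /=; apply: eq_bigr => k _.
  rewrite !mxE mulr_sumr; apply: eq_bigr => l _; rewrite !mxE; ring.
rewrite !mxE mulr_suml; apply: eq_bigr => l _; rewrite !mxE; ring.
Qed.

(** The Gubinelli derivative of [Sigma V] where [V = x], the equation giving
    [V' = Sigma x]. *)
Definition lin_deriv S Sd x := tensor_mul_deriv S Sd x (tensor_mul S x).

Definition germ S Sd x a (M : 'M[R]_d) : 'cV[R]_n :=
  tensor_mul S x *m a + deriv_contract (lin_deriv S Sd x) M.

Lemma germB S Sd x y a M :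
  germ S Sd (x - y) a M = germ S Sd x a M - germ S Sd y a M.
Proof.
rewrite /germ /lin_deriv !tensor_mulDr tensor_mulNr mulmxBl.
rewrite tensor_mul_derivDr tensor_mul_derivNr deriv_contractDl deriv_contractNl.
by rewrite opprD addrACA.
Qed.

(** Chen's relation turns the defect of additivity of the germ into the
    remainder of the controlled path [Sigma V] over the first interval, paired
    with [X], plus the increment of its derivative, paired with [XX].  The value [y]
    at the intermediate time is arbitrary: it is the one-step
    approximation in [one_step_defect] and the solution itself in
    [expansion_of_solution]. *)
Lemma germ_chen S Sd U Ud x y a b (M P : 'M[R]_d) :
  germ S Sd x a M + germ U Ud y b P - germ S Sd x (a + b) (M + P + a *m b^T) =
  (tensor_mul (U - S - Sd *m a) x + tensor_mul (U - S) (y - x)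
   + tensor_mul S (y - x - tensor_mul S x *m a)) *m b
  + deriv_contract (lin_deriv U Ud y - lin_deriv S Sd x) P.
Proof.
rewrite /germ !deriv_contractDr {4}/lin_deriv deriv_contract_tensor mulmxDr.
rewrite deriv_contractDl deriv_contractNl.
rewrite !(tensor_mulDl, tensor_mulDr, tensor_mulNl, tensor_mulNr).
rewrite !(mulmxDl, mulNmx).
by apply/matrixP => i z; rewrite !mxE; ring.
Qed.

Lemma norm_lin_deriv S Sd x (M : R) :
  1 <= M -> `|S| <= M -> `|Sd| <= M ->
  `|lin_deriv S Sd x| <= 2 * bilin_const ^+ 2 * M ^+ 2 * `|x|.
Proof.
move=> M1 SM SdM; have c1 := bilin_const_ge1.
apply: (le_trans (norm_tensor_mul_deriv _ _ _ _)).
have h1 : `|tensor_mul S x| <= bilin_const * M * `|x|.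
  by apply: (le_trans (norm_tensor_mul _ _)); rewrite ler_wpM2r// ler_wpM2l//; lra.
have -> : 2 * bilin_const ^+ 2 * M ^+ 2 * `|x| =
  bilin_const * M * (bilin_const * M * `|x|) + bilin_const * M * (bilin_const * M * `|x|) by ring.
have cM1 : 1 <= bilin_const * M by rewrite -[leLHS]mulr1 ler_pM.
have cM : 0 <= bilin_const * M by lra.
apply: lerD.
  by apply: ler_pM => //; rewrite ?mulr_ge0 ?ler_wpM2l//; lra.
apply: ler_pM => //; rewrite ?mulr_ge0 ?ler_wpM2l//; try lra.
by rewrite ler_peMl.
Qed.

Lemma norm_lin_derivB S Sd U Ud x y (M : R) :
  1 <= M -> `|S| <= M -> `|Sd| <= M -> `|U| <= M -> `|Ud| <= M ->
  `|lin_deriv U Ud y - lin_deriv S Sd x| <=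
   2 * bilin_const ^+ 2 * M ^+ 2 * ((`|U - S| + `|Ud - Sd|) * `|y| + `|y - x|).
Proof.
move=> M1 SM SdM UM UdM; have c1 := bilin_const_ge1.
have -> : lin_deriv U Ud y - lin_deriv S Sd x =
    tensor_mul_deriv (U - S) (Ud - Sd) y (tensor_mul U y)
    + tensor_mul_deriv S Sd 0 (tensor_mul (U - S) y)
    + lin_deriv S Sd (y - x).
  have -> : tensor_mul_deriv S Sd 0 (tensor_mul (U - S) y) =
      tensor_mul_deriv S Sd y (tensor_mul U y) - lin_deriv S Sd y.
    rewrite /lin_deriv -tensor_mul_derivNr -tensor_mul_derivDr subrr.
    by rewrite tensor_mulDl tensor_mulNl.
  rewrite /lin_deriv tensor_mul_derivD tensor_mul_derivN.
  rewrite tensor_mulDr tensor_mulNr tensor_mul_derivDr tensor_mul_derivNr.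
  by rewrite !addrA !subrK.
have cM1 : 1 <= bilin_const * M by rewrite -[leLHS]mulr1 ler_pM.
have cM : 0 <= bilin_const * M by lra.
apply: (le_trans (ler_normD _ _)); rewrite mulrDr; apply: lerD; last exact: norm_lin_deriv.
apply: (le_trans (ler_normD _ _)).
apply: (le_trans (lerD (norm_tensor_mul_deriv _ _ _ _) (norm_tensor_mul_deriv _ _ _ _))).
rewrite normr0 mulr0 addr0.
have h1 : `|tensor_mul U y| <= bilin_const * M * `|y|.
  by apply: (le_trans (norm_tensor_mul _ _)); rewrite ler_wpM2r// ler_wpM2l//; lra.
have h2 := norm_tensor_mul (U - S) y.
set u := `|U - S| in h2 *; set u' := `|Ud - Sd|.
have u0 : 0 <= u by exact: normr_ge0.
have u'0 : 0 <= u' by exact: normr_ge0.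
have e1 : bilin_const * u * `|tensor_mul U y| <= bilin_const * u * (bilin_const * M * `|y|).
  by rewrite ler_wpM2l// mulr_ge0//; lra.
have e2 : bilin_const * `|S| * `|tensor_mul (U - S) y| <= bilin_const * M * (bilin_const * u * `|y|).
  by apply: ler_pM => //; rewrite ?mulr_ge0 ?ler_wpM2l//; lra.
have e3 : bilin_const * u' * `|y| <= bilin_const * u' * (bilin_const * M) * `|y|.
  by rewrite ler_wpM2r// ler_peMr// mulr_ge0//; lra.
apply: (@le_trans _ _ (2 * bilin_const ^+ 2 * M * ((u + u') * `|y|))).
  have : 0 <= bilin_const ^+ 2 * M * (u' * `|y|) by rewrite !mulr_ge0// ?sqr_ge0//; lra.
  move: e1 e2 e3; lra.
have M2 : M <= M ^+ 2 by rewrite expr2 ler_peMr//; lra.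
have c20 : 0 <= 2 * bilin_const ^+ 2 by rewrite mulr_ge0 ?sqr_ge0.
by rewrite ler_wpM2r ?mulr_ge0 ?addr_ge0// ler_wpM2l.
Qed.

(** The two terms of [germ_chen] are products of orders [2 + 1] and [1 + 2] in
    [q]; both factors are proportional to [e], so the square of [e] is left to
    absorb constants. *)
Lemma germ_defect S Sd U Ud x y a b (M P : 'M[R]_d) (C e q Y D : R) :
  1 <= C -> 0 <= e <= 1 -> 0 <= q ->
  `|S| <= C -> `|Sd| <= C -> `|U| <= C -> `|Ud| <= C ->
  `|U - S| <= e * q -> `|Ud - Sd| <= e * q -> `|b| <= e * q ->
  `|U - S - Sd *m a| <= e * q ^+ 2 -> `|P| <= e * q ^+ 2 ->
  `|x| <= Y -> `|y| <= Y ->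
  `|y - x| <= D * e * q -> `|y - x - tensor_mul S x *m a| <= D * e * q ^+ 2 ->
  `|germ S Sd x a M + germ U Ud y b P - germ S Sd x (a + b) (M + P + a *m b^T)|
    <= bilin_const ^+ 3 * C ^+ 2 * (5 * Y + 4 * D) * e ^+ 2 * q ^+ 3.
Proof.
move=> C1 /andP[e0 e1] q0 SC SdC UC UdC US US' be RS Pe xY yY yx yxr.
have c1 := bilin_const_ge1; have c0 := bilin_const_ge0.
have eq0 : 0 <= e * q by exact: mulr_ge0.
have eqq0 : 0 <= e * q ^+ 2 by rewrite mulr_ge0// sqr_ge0.
have Y0 : 0 <= Y by exact: le_trans xY.
have De0 : 0 <= D * e * q by exact: le_trans yx.
have Deq0 : 0 <= D * e * q ^+ 2 by exact: le_trans yxr.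
rewrite germ_chen; apply: (le_trans (ler_normD _ _)).
apply: (le_trans (lerD (norm_mulmx_nd _ _) (norm_deriv_contract _ _))).
have h1 : `|tensor_mul (U - S - Sd *m a) x + tensor_mul (U - S) (y - x)
   + tensor_mul S (y - x - tensor_mul S x *m a)| <=
   bilin_const * (e * q ^+ 2) * Y + bilin_const * (e * q) * (D * e * q)
   + bilin_const * C * (D * e * q ^+ 2).
  apply: (le_trans (ler_normD _ _)); apply: lerD.
    apply: (le_trans (ler_normD _ _)); apply: lerD.
      apply: (le_trans (norm_tensor_mul _ _)).
      by apply: ler_pM => //; rewrite ?mulr_ge0 ?ler_wpM2l.
    apply: (le_trans (norm_tensor_mul _ _)).
    by apply: ler_pM => //; rewrite ?mulr_ge0 ?ler_wpM2l.
  apply: (le_trans (norm_tensor_mul _ _)).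
  by apply: ler_pM => //; rewrite ?mulr_ge0 ?ler_wpM2l.
have h2 : `|lin_deriv U Ud y - lin_deriv S Sd x| <=
    2 * bilin_const ^+ 2 * C ^+ 2 * ((e * q + e * q) * Y + D * e * q).
  apply: (le_trans (norm_lin_derivB _ _ C1 SC SdC UC UdC)).
  have c20 : 0 <= 2 * bilin_const ^+ 2 * C ^+ 2 by rewrite mulr_ge0 ?sqr_ge0// mulr_ge0 ?sqr_ge0.
  rewrite ler_wpM2l//.
  by apply: lerD => //; apply: ler_pM => //; rewrite ?addr_ge0// lerD.
set E1 := _ + _ + bilin_const * C * _ in h1.
set E2 := 2 * _ * _ * _ in h2.
have E10 : 0 <= E1 by exact: le_trans h1.
have E20 : 0 <= E2 by exact: le_trans h2.
apply: (@le_trans _ _ (bilin_const * E1 * (e * q) + bilin_const * E2 * (e * q ^+ 2))).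
  apply: lerD.
    by apply: ler_pM => //; rewrite ?mulr_ge0// ler_wpM2l.
  by apply: ler_pM => //; rewrite ?mulr_ge0// ler_wpM2l.
have E1b : E1 <= bilin_const * C ^+ 2 * (e * q ^+ 2 * Y + 2 * (D * e * q ^+ 2)).
  have C21 : C <= C ^+ 2 by rewrite expr2 ler_peMr//; lra.
  have C22 : 1 <= C ^+ 2 by lra.
  have t1 : bilin_const * (e * q ^+ 2) * Y <= bilin_const * C ^+ 2 * (e * q ^+ 2 * Y).
    by rewrite -mulrA ler_wpM2r ?mulr_ge0 ?sqr_ge0// ler_peMr.
  have t2 : bilin_const * (e * q) * (D * e * q) <= bilin_const * C ^+ 2 * (D * e * q ^+ 2).
    have -> : bilin_const * (e * q) * (D * e * q) = bilin_const * e * (D * e * q ^+ 2) by ring.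
    by rewrite ler_wpM2r// ler_wpM2l//; lra.
  have t3 : bilin_const * C * (D * e * q ^+ 2) <= bilin_const * C ^+ 2 * (D * e * q ^+ 2).
    by rewrite ler_wpM2r// ler_wpM2l.
  rewrite /E1; move: t1 t2 t3; lra.
have T1 : bilin_const * E1 * (e * q) <=
   bilin_const ^+ 3 * C ^+ 2 * (Y + 2 * D) * e ^+ 2 * q ^+ 3.
  have T0 : 0 <= bilin_const * C ^+ 2 * (e * q ^+ 2 * Y + 2 * (D * e * q ^+ 2)).
    exact: le_trans E1b.
  apply: (@le_trans _ _ (bilin_const * (bilin_const * (bilin_const * C ^+ 2
    * (e * q ^+ 2 * Y + 2 * (D * e * q ^+ 2)))) * (e * q))).
    rewrite ler_wpM2r// ler_wpM2l// (le_trans E1b)// ler_peMl//.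
  by rewrite le_eqVlt; apply/orP; left; apply/eqP; ring.
apply: (le_trans (lerD T1 (lexx _))).
by rewrite le_eqVlt; apply/orP; left; apply/eqP; rewrite /E2; ring.
Qed.

End germ.

(** * One-step maps and Euler schemes *)

Section pointwise_limit.
Context {R : realType} {n : nat}.

(** Functions bounded at each point for all large finite sets [F] have a pointwise
    limit along an ultrafilter finer than the filter of large finite sets; it is
    approximated at finitely many points simultaneously by some large [F]. *)
Lemma finite_approx_limit (dom : set R) (val : seq R -> R -> 'cV[R]_n) :
  (forall t, dom t -> exists (M : R) (F0 : seq R),
     forall F : seq R, {subset F0 <= F} -> `|val F t| <= M) ->
  exists V : R -> 'cV[R]_n, forall (e : R) (pts F0 : seq R), 0 < e ->
    (forall t, t \in pts -> dom t) ->
    exists2 F : seq R, {subset F0 <= F} &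
      forall t, t \in pts -> `|val F t - V t| <= e.
Proof.
move=> bnd.
pose G : set_system (seq R) :=
  filter_from setT (fun F0 : seq R => [set F : seq R | {subset F0 <= F}]).
have GF : ProperFilter G.
  apply: filter_from_proper; last by move=> F0 _; exists F0.
  apply: filter_from_filter; first by exists [::].
  move=> F1 F2 _ _; exists (F1 ++ F2) => // F sF.
  by split=> x xF; apply: sF; rewrite mem_cat xF ?orbT.
have [U [UU GU]] := ultraFilterLemma GF.
have lim1 t (i : 'I_n) : dom t -> exists l : R, forall e : R, 0 < e ->
    U [set F : seq R | `|val F t i 0 - l| <= e].
  move=> dt; have [M [F0 hM]] := bnd t dt.
  have := @segment_compact R (- M) M ((fun F => val F t i 0) @ U) _.
  case=> [|l [_ cl]].
    apply: GU; exists F0 => // F sF.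
    by rewrite /= in_itv /= -ler_norml (le_trans (mx_entry_le _ _ _))// hM.
  exists l => e e0; have [//|UC] := in_ultra_setVsetC [set F : seq R | `|val F t i 0 - l| <= e] UU.
  have [z [/= ze zb]] : [set z : R | ~ `|z - l| <= e] `&` ball l e !=set0.
    by apply: cl; [exact: UC|exact: nbhsx_ballx].
  by exfalso; apply: ze; rewrite distrC ltW.
have [lim limP] : {lim : R -> 'I_n -> R | forall t i, dom t -> forall e : R, 0 < e ->
    U [set F : seq R | `|val F t i 0 - lim t i| <= e]}.
  have lim2 t i : {l : R | dom t -> forall e : R, 0 < e ->
     U [set F : seq R | `|val F t i 0 - l| <= e]}.
    apply: cid; have [dt|ndt] := pselect (dom t); last by exists 0.
    by have [l hl] := lim1 t i dt; exists l.
  by exists (fun t i => sval (lim2 t i)) => t i; exact: (svalP (lim2 t i)).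
exists (fun t => \col_i lim t i) => e pts F0 e0 dpts.
have Ut t : t \in pts -> U [set F : seq R | `|val F t - \col_i lim t i| <= e].
  move=> /dpts dt.
  apply: (@filterS _ _ _ [set F : seq R | forall i, `|val F t i 0 - lim t i| <= e]).
    move=> F /= h; apply: mx_norm_le => [|i j]; first exact: ltW.
    by rewrite (ord1 j) !mxE; exact: h.
  by apply: filter_forall => i; exact: limP.
have {}Ut : U [set F : seq R | forall t, t \in pts -> `|val F t - \col_i lim t i| <= e].
  elim: pts Ut {dpts} => [|p pts IH] Ut; first by apply: filterS filterT => F _ t.
  have IH' := IH (fun t tp => Ut t (mem_behead (tp : t \in behead (p :: pts)))).
  have Up := Ut p (mem_head _ _).
  apply: filterS (filterI IH' Up) => F [h1 h2] t.
  by rewrite inE => /predU1P[->|tp]; [exact: h2|exact: h1].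
have U0 : U [set F : seq R | {subset F0 <= F}] by apply: GU; exists F0.
have [F [h1 h2]] := filter_ex (filterI U0 Ut).
by exists F.
Qed.

End pointwise_limit.

Section flow.
Context {R : realType} {n d : nat}.
Variables (T : R) (phi : R -> R) (alpha C : R).
Variables (X : R -> 'cV[R]_d) (XX : R -> R -> 'M[R]_d).
Variables (Sigma : R -> 'cV[R]_(n * d * n)) (Sigma' : R -> 'M[R]_(n * d * n, d)).
Variable (B : R -> R -> 'M[R]_n).
Implicit Types (e h s r t : R) (F : seq R).

(** All that the analysis of the equation uses of its data.  [B s t] stands for
    the integral of [A] over [s, t]; being of order [t - s], it is a
    second-order term like [XX]. *)
Record driver : Prop := Driver {
  drv_control : is_control T phi;
  drv_alpha : 0 < alpha;
  drv_alpha3 : 1 < alpha * 3;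
  drv_C : 1 <= C;
  drv_range : (phi T - phi 0) `^ alpha <= C;
  drv_Sigma : forall t, 0 <= t <= T -> `|Sigma t| <= C;
  drv_Sigma' : forall t, 0 <= t <= T -> `|Sigma' t| <= C;
  drv_chen : forall s r t, 0 <= s -> s <= r -> r <= t -> t <= T ->
    XX s t = XX s r + XX r t + increment X s r *m (increment X r t)^T;
  drv_XX0 : forall s, 0 <= s <= T -> XX s s = 0;
  drv_B : forall s r t, B s t = B s r + B r t;
  drv_X_small : small T phi alpha (increment X);
  drv_Sigma_small : small T phi alpha (increment Sigma);
  drv_Sigma'_small : small T phi alpha (increment Sigma');
  drv_XX_small : small T phi (alpha * 2) XX;
  drv_R_small : small T phi (alpha * 2) (remainder X Sigma Sigma');
  drv_B_small : small T phi (alpha * 2) B }.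

Hypothesis D : driver.

Local Notation q s t := ((phi t - phi s) `^ alpha).

Definition at_scale e h := forall s t, 0 <= s -> s <= t -> t <= T -> t - s <= h ->
  [/\ `|increment X s t| <= e * q s t, `|increment Sigma s t| <= e * q s t
    & `|increment Sigma' s t| <= e * q s t] /\
  [/\ `|XX s t| <= e * q s t ^+ 2, `|remainder X Sigma Sigma' s t| <= e * q s t ^+ 2
    & `|B s t| <= e * q s t ^+ 2].

Lemma control_powX s t k : (phi t - phi s) `^ (alpha * k%:R) = q s t ^+ k.
Proof. by rewrite powRrM powR_mulrn// powR_ge0. Qed.

Lemma exists_scale e : 0 < e -> exists2 h, 0 < h & at_scale e h.
Proof.
move=> e0.
have [h1 h10 H1] := drv_X_small D e0.
have [h2 h20 H2] := drv_Sigma_small D e0.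
have [h3 h30 H3] := drv_Sigma'_small D e0.
have [h4 h40 H4] := drv_XX_small D e0.
have [h5 h50 H5] := drv_R_small D e0.
have [h6 h60 H6] := drv_B_small D e0.
exists (Num.min h1 (Num.min h2 (Num.min h3 (Num.min h4 (Num.min h5 h6))))).
  by rewrite !lt_min h10 h20 h30 h40 h50 h60.
move=> s t s0 st tT; rewrite !le_min.
case/andP=> d1 /andP[d2 /andP[d3 /andP[d4 /andP[d5 d6]]]].
have := H4 s t s0 st tT d4; have := H5 s t s0 st tT d5; have := H6 s t s0 st tT d6.
rewrite !control_powX => b6 b5 b4; split; split=> //.
- exact: H1.
- exact: H2.
- exact: H3.
Qed.

Lemma q_ge0 s t : 0 <= q s t. Proof. exact: powR_ge0. Qed.

Lemma q_sub a s t b : 0 <= a -> a <= s -> s <= t -> t <= b -> b <= T -> q s t <= q a b.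
Proof. by move=> *; apply: (powR_subadd (drv_control D) (ltW (drv_alpha D))). Qed.

Lemma q_le s t : 0 <= s -> s <= t -> t <= T -> q s t <= C.
Proof. by move=> *; apply: le_trans (drv_range D); apply: q_sub. Qed.

Definition one_step s t (x : 'cV[R]_n) : 'cV[R]_n :=
  x + B s t *m x + germ (Sigma s) (Sigma' s) x (increment X s t) (XX s t).

Lemma one_stepB s t x y : one_step s t (x - y) = one_step s t x - one_step s t y.
Proof.
rewrite /one_step germB mulmxBr; rewrite !opprD !addrA.
by apply/matrixP => i z; rewrite !(mx_addE, mx_oppE); ring.
Qed.

Lemma one_step_id s x : 0 <= s <= T -> one_step s s x = x.
Proof.
move=> s0T; rewrite /one_step (drv_XX0 D s0T) /increment subrr /germ.
have -> : B s s = 0.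
  by have /esym/eqP := drv_B D s s s; rewrite -subr_eq0 addrK => /eqP.
have -> : deriv_contract (lin_deriv (Sigma s) (Sigma' s) x) 0 = 0.
  apply/matrixP => i z; rewrite !mxE big1// => j _; rewrite big1// => l _.
  by rewrite !mxE mulr0.
by rewrite mul0mx mulmx0 !addr0.
Qed.

Let c : R := @bilin_const R n d.
Let c1 : 1 <= c. Proof. exact: bilin_const_ge1. Qed.
Let C1 := drv_C D.

Definition close_const : R := 5 * c ^+ 3 * C ^+ 3.

Lemma close_const_gt0 : 0 < close_const.
Proof.
have := C1; have := c1 => c1' C1'.
by rewrite mulr_gt0 ?exprn_gt0 ?mulr_gt0 ?exprn_gt0//; lra.
Qed.

(** Beyond the first-order term [Sigma_s x X_(s,t)], all the terms of the step are of
    order two. *)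
Lemma one_step_close e h s t x : 0 <= e -> at_scale e h ->
  0 <= s -> s <= t -> t <= T -> t - s <= h ->
  `|one_step s t x - x| <= close_const * e * q s t * `|x| /\
  `|one_step s t x - x - tensor_mul (Sigma s) x *m increment X s t|
     <= close_const * e * q s t ^+ 2 * `|x|.
Proof.
move=> e0 sc s0 st tT sth.
have [[bX _ _] [bXX _ bB]] := sc s t s0 st tT sth.
have C1' := C1; have c1' := c1.
have s0T : 0 <= s <= T by rewrite s0 (le_trans st).
have Q0 := q_ge0 s t; have QC := q_le s0 st tT.
set Q := q s t in bX bXX bB Q0 QC *.
have x0 := normr_ge0 x; set z := `|x| in x0 *.
have c0 : 0 <= c by lra.
have C0 : 0 <= C by lra.
have eQ0 : 0 <= e * Q ^+ 2 by rewrite mulr_ge0// exprn_ge0.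
have hB : `|B s t *m x| <= c * (e * Q ^+ 2) * z.
  apply: (le_trans (@norm_mulmx_nn R n d _ _)); rewrite ler_wpM2r// ler_wpM2l//.
have hL : `|lin_deriv (Sigma s) (Sigma' s) x| <= 2 * c ^+ 2 * C ^+ 2 * z.
  by apply: norm_lin_deriv => //; [exact: (drv_Sigma D)|exact: (drv_Sigma' D)].
have hG : `|deriv_contract (lin_deriv (Sigma s) (Sigma' s) x) (XX s t)| <=
    c * (2 * c ^+ 2 * C ^+ 2 * z) * (e * Q ^+ 2).
  apply: (le_trans (norm_deriv_contract _ _)).
  by apply: ler_pM => //; [rewrite mulr_ge0|rewrite ler_wpM2l].
have hT : `|tensor_mul (Sigma s) x *m increment X s t| <= c * (c * C * z) * (e * Q).
  apply: (le_trans (norm_mulmx_nd _ _)); apply: ler_pM => //; first by rewrite mulr_ge0.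
  rewrite ler_wpM2l// (le_trans (norm_tensor_mul _ _))// ler_wpM2r// ler_wpM2l//.
  exact: (drv_Sigma D).
have cc : c <= c ^+ 3 by rewrite exprS ler_peMr// exprn_ege1.
have cc2 : c ^+ 2 <= c ^+ 3 by rewrite [leRHS]exprS ler_peMl// exprn_ge0.
have CC : 1 <= C ^+ 2 by rewrite exprn_ege1.
have CC3 : C ^+ 2 <= C ^+ 3 by rewrite [leRHS]exprS ler_peMl// exprn_ge0.
have CC1 : C <= C ^+ 3 by rewrite exprS ler_peMr.
have c30 : 0 <= c ^+ 3 by rewrite exprn_ge0.
have eQz0 : 0 <= e * Q ^+ 2 * z by rewrite mulr_ge0.
have eQz1 : 0 <= e * Q * z by rewrite !mulr_ge0.
have B2 : `|B s t *m x + deriv_contract (lin_deriv (Sigma s) (Sigma' s) x) (XX s t)| <=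
    3 * c ^+ 3 * C ^+ 2 * (e * Q ^+ 2 * z).
  apply: (le_trans (ler_normD _ _)); apply: (le_trans (lerD hB hG)).
  have : c * (e * Q ^+ 2 * z) <= c ^+ 3 * C ^+ 2 * (e * Q ^+ 2 * z).
    by rewrite ler_wpM2r// (le_trans cc)// ler_peMr.
  have -> : c * (2 * c ^+ 2 * C ^+ 2 * z) * (e * Q ^+ 2) = 2 * (c ^+ 3 * C ^+ 2 * (e * Q ^+ 2 * z)) by ring.
  lra.
have E2 : one_step s t x - x - tensor_mul (Sigma s) x *m increment X s t =
    B s t *m x + deriv_contract (lin_deriv (Sigma s) (Sigma' s) x) (XX s t).
  rewrite /one_step /germ; apply/matrixP => i w; rewrite !(mx_addE, mx_oppE); ring.
have K2 : 3 * c ^+ 3 * C ^+ 2 * (e * Q ^+ 2 * z) <= close_const * e * Q ^+ 2 * z.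
  have -> : close_const * e * Q ^+ 2 * z = 5 * c ^+ 3 * C ^+ 3 * (e * Q ^+ 2 * z).
    by rewrite /close_const; ring.
  rewrite ler_wpM2r//; apply: ler_pM; rewrite ?mulr_ge0 ?exprn_ge0//.
  by rewrite ler_wpM2r//; lra.
split; last by rewrite E2; apply: le_trans K2.
have -> : one_step s t x - x = (one_step s t x - x - tensor_mul (Sigma s) x *m increment X s t)
   + tensor_mul (Sigma s) x *m increment X s t by rewrite subrK.
apply: (le_trans (ler_normD _ _)); rewrite E2.
apply: (le_trans (lerD B2 hT)).
have t1 : 3 * c ^+ 3 * C ^+ 2 * (e * Q ^+ 2 * z) <= 3 * c ^+ 3 * C ^+ 3 * (e * Q * z).
  have -> : 3 * c ^+ 3 * C ^+ 2 * (e * Q ^+ 2 * z) =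
     3 * c ^+ 3 * C ^+ 2 * Q * (e * Q * z) by ring.
  have -> : 3 * c ^+ 3 * C ^+ 3 * (e * Q * z) = 3 * c ^+ 3 * C ^+ 2 * C * (e * Q * z) by ring.
  by rewrite ler_wpM2r// ler_wpM2l// mulr_ge0 ?exprn_ge0// mulr_ge0.
have t2 : c * (c * C * z) * (e * Q) <= c ^+ 3 * C ^+ 3 * (e * Q * z).
  have -> : c * (c * C * z) * (e * Q) = c ^+ 2 * C * (e * Q * z) by ring.
  by rewrite ler_wpM2r//; apply: ler_pM => //; rewrite exprn_ge0.
have t3 : 0 <= c ^+ 3 * C ^+ 3 * (e * Q * z) by rewrite !mulr_ge0// exprn_ge0.
rewrite /close_const; move: t1 t2 t3; lra.
Qed.

Definition defect_const : R :=
  c ^+ 3 * C ^+ 2 * (5 * (1 + close_const * C) + 4 * close_const) + c * close_const.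

Lemma defect_const_gt0 : 0 < defect_const.
Proof.
have C1' := C1; have c1' := c1; have D00 := close_const_gt0.
have h1 : 0 <= close_const * C by rewrite mulr_ge0//; lra.
have cp : 0 < c by lra.
have Cp : 0 < C by lra.
have h2 : 0 < 5 * (1 + close_const * C) + 4 * close_const by lra.
have h3 : 0 < c ^+ 3 * C ^+ 2 by rewrite mulr_gt0// exprn_gt0.
by rewrite /defect_const addr_gt0// mulr_gt0.
Qed.

(** The only part of the defect that is not due to the germ is [B r t] applied to
    the increment of the first step. *)
Lemma one_step_defect e h s r t x : 0 <= e <= 1 -> at_scale e h ->
  0 <= s -> s <= r -> r <= t -> t <= T -> t - s <= h ->
  `|one_step r t (one_step s r x) - one_step s t x| <= defect_const * e ^+ 2 * q s t ^+ 3 * `|x|.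
Proof.
move=> /andP[e0 e1] sc s0 sr rt tT sth.
have C1' := C1; have c1' := c1; have D00 := close_const_gt0.
have rT := le_trans rt tT; have r0 := le_trans s0 sr; have st := le_trans sr rt.
have srh : r - s <= h by apply: le_trans sth; rewrite lerB.
have rth : t - r <= h by apply: le_trans sth; rewrite lerB.
have [cl1 cl2] := one_step_close x e0 sc s0 sr rT srh.
set y := one_step s r x in cl1 cl2 *.
have Q0 := q_ge0 s t; have QC := q_le s0 st tT.
have qsr : q s r <= q s t by exact: q_sub.
have qrt : q r t <= q s t by exact: q_sub.
have [[_ bSg bSgd] [_ bR _]] := sc s r s0 sr rT srh.
have [[bX _ _] [bXX _ bB]] := sc r t r0 rt tT rth.
have sqr2 a : 0 <= a -> a <= q s t -> a ^+ 2 <= q s t ^+ 2 by move=> *; rewrite lerXn2r.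
have qsr2 := sqr2 _ (q_ge0 s r) qsr; have qrt2 := sqr2 _ (q_ge0 r t) qrt.
set Q := q s t in Q0 QC qsr qrt qsr2 qrt2 *.
have z0 := normr_ge0 x; set z := `|x| in z0 cl1 cl2 *.
have Dz : 0 <= close_const * z := mulr_ge0 (ltW D00) z0.
have Dze : 0 <= close_const * z * e := mulr_ge0 Dz e0.
have DC : 0 <= close_const * C by apply: mulr_ge0; [exact: ltW|lra].
have {}cl1 : `|y - x| <= close_const * z * e * Q.
  apply: (le_trans cl1).
  have -> : close_const * e * q s r * z = close_const * z * e * q s r by ring.
  by rewrite ler_wpM2l.
have {}cl2 : `|y - x - tensor_mul (Sigma s) x *m increment X s r| <= close_const * z * e * Q ^+ 2.
  apply: (le_trans cl2).
  have -> : close_const * e * q s r ^+ 2 * z = close_const * z * e * q s r ^+ 2 by ring.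
  by rewrite ler_wpM2l.
have up (a b b' : R) : a <= e * b -> b <= b' -> a <= e * b'.
  by move=> ab bb; apply: (le_trans ab); rewrite ler_wpM2l.
have yz : `|y| <= (1 + close_const * C) * z.
  have -> : y = x + (y - x) by rewrite addrC subrK.
  apply: (le_trans (ler_normD _ _)); rewrite mulrDl mul1r lerD2l (le_trans cl1)//.
  have -> : close_const * z * e * Q = (close_const * z) * (e * Q) by ring.
  have -> : close_const * C * z = (close_const * z) * C by ring.
  by rewrite ler_wpM2l// (le_trans _ QC)// ler_piMl.
have xz : `|x| <= (1 + close_const * C) * z.
  by rewrite -/z mulrDl mul1r lerDl mulr_ge0.
have -> : one_step r t y - one_step s t x =
    (germ (Sigma s) (Sigma' s) x (increment X s r) (XX s r)
     + germ (Sigma r) (Sigma' r) y (increment X r t) (XX r t)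
     - germ (Sigma s) (Sigma' s) x (increment X s t) (XX s t)) + B r t *m (y - x).
  rewrite /one_step (drv_B D s r t) mulmxDl mulmxBr.
  have -> : germ (Sigma s) (Sigma' s) x (increment X s r) (XX s r) = y - x - B s r *m x.
    rewrite /y /one_step; apply/matrixP => i w; rewrite !(mx_addE, mx_oppE); ring.
  apply/matrixP => i w; rewrite !(mx_addE, mx_oppE); ring.
have -> : increment X s t = increment X s r + increment X r t.
  by rewrite /increment [RHS]addrC subrKA.
rewrite (drv_chen D s0 sr rt tT).
have s0T : 0 <= s <= T by rewrite s0 (le_trans st).
have r0T : 0 <= r <= T by rewrite r0.
apply: (le_trans (ler_normD _ _)).
have G := @germ_defect R n d (Sigma s) (Sigma' s) (Sigma r) (Sigma' r) x y
  (increment X s r) (increment X r t) (XX s r) (XX r t) C e Q ((1 + close_const * C) * z) (close_const * z).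
have c0 : 0 <= c by lra.
have H : `|B r t *m (y - x)| <= c * (e * Q ^+ 2) * (close_const * z * e * Q).
  apply: (le_trans (@norm_mulmx_nn R n d _ _)); apply: ler_pM => //.
    by apply: mulr_ge0 => //; exact: c0.
  by apply: ler_wpM2l; [exact: c0|exact: up bB _].
apply: (@le_trans _ _ (c ^+ 3 * C ^+ 2 * (5 * ((1 + close_const * C) * z) + 4 * (close_const * z))
   * e ^+ 2 * Q ^+ 3 + c * (e * Q ^+ 2) * (close_const * z * e * Q))).
  apply: lerD => //; apply: G => //.
  - by rewrite e0.
  - exact: (drv_Sigma D).
  - exact: (drv_Sigma' D).
  - exact: (drv_Sigma D).
  - exact: (drv_Sigma' D).
  - exact: up bSg _.
  - exact: up bSgd _.
  - exact: up bX _.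
  - exact: up bR _.
  - exact: up bXX _.
by rewrite le_eqVlt; apply/orP; left; apply/eqP; rewrite /defect_const; ring.
Qed.

(** [sewing_on] for the one-step maps with the size [|x| + delta].  The constant
    [kappa] does not depend on [eps], so the conclusion is again a little-o.  The
    last bound is what makes the Euler schemes bounded. *)
Lemma flow_estimate : exists (kappa eps0 : R), [/\ 1 <= kappa, 0 < eps0 &
  forall eps : R, 0 < eps -> eps <= eps0 -> exists2 h, 0 < h &
  forall (delta : R) (u : nat -> R) (y : nat -> 'cV[R]_n) k, 0 <= delta ->
    (forall i j, (i <= j <= k)%N -> u i <= u j) -> 0 <= u 0%N -> u k <= T ->
    u k - u 0%N <= h ->
    (forall i, (i < k)%N -> `|y i.+1 - one_step (u i) (u i.+1) (y i)| <=
      eps * (phi (u i.+1) - phi (u i)) `^ (alpha * 3) * (`|y i| + delta)) ->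
    `|y k - one_step (u 0%N) (u k) (y 0%N)| <=
      kappa * eps * (phi (u k) - phi (u 0%N)) `^ (alpha * 3) * (`|y 0%N| + delta)
    /\ `|y k| <= 2 * (`|y 0%N| + delta)].
Proof.
have th1 := drv_alpha3 D; have th0 : 0 < alpha * 3 by lra.
have cphi := drv_control D.
have [eta [kappa [eta0 eta2 kappa1 hk]]] := sewing_constants th1.
pose W := (phi T - phi 0) `^ (alpha * 3) + 1.
have W0 : 0 < W by rewrite ltr_wpDl ?powR_ge0.
have kap0 : 0 < kappa by lra.
exists kappa, (eta / (kappa * W)); split => //.
  by rewrite divr_gt0// mulr_gt0.
move=> eps eps0 epsl.
have D00 := close_const_gt0; set DD := close_const in D00.
have D10 := defect_const_gt0; set EE := defect_const in D10.
have C0 : 0 < C by have := drv_C D; lra.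
pose e : R := Num.min 1 (Num.min (eta / (DD * C)) (eps / EE)).
have DC0 : 0 < DD * C by exact: mulr_gt0 D00 C0.
have e0 : 0 < e by rewrite !lt_min ltr01 (divr_gt0 eta0 DC0) (divr_gt0 eps0 D10).
have De0 : 0 <= DD * e := mulr_ge0 (ltW D00) (ltW e0).
have e1 : e <= 1 by rewrite ge_min lexx.
have e2 : DD * e * C <= eta.
  rewrite mulrAC mulrC -(ler_pdivlMr _ _ DC0).
  by rewrite !ge_min lexx orbT.
have e3 : EE * e ^+ 2 <= eps.
  apply: (@le_trans _ _ (EE * e)); first by rewrite ler_wpM2l ?(ltW D10)// expr2 ler_piMl// ltW.
  by rewrite mulrC -(ler_pdivlMr _ _ D10) !ge_min lexx !orbT.
have [h h0 sc] := exists_scale e0.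
exists h => // delta u y k delta0 umon u0 ukT ukh ystep.
have sub a b s t : a <= s -> t <= b -> t - s <= b - a by move=> ? ?; apply: lerB.
have close s t x : u 0%N <= s -> s <= t -> t <= u k -> `|one_step s t x - x| <= eta * `|x|.
  move=> us st tu; have s0 := le_trans u0 us; have tT := le_trans tu ukT.
  have sth : t - s <= h by apply: le_trans ukh; apply: sub.
  have [+ _] := one_step_close x (ltW e0) sc s0 st tT sth.
  move=> /le_trans; apply; rewrite ler_wpM2r// (le_trans _ e2)// ler_wpM2l//.
  exact: (q_le s0 st tT).
have growth s t x : u 0%N <= s -> s <= t -> t <= u k -> `|one_step s t x| <= (1 + eta) * `|x|.
  move=> us st tu; have := close s t x us st tu; have := ler_normD (one_step s t x - x) x.
  rewrite subrK; lra.
have kW : kappa * eps * (phi T - phi 0) `^ (alpha * 3) <= eta.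
  apply: (@le_trans _ _ (kappa * eps * W)).
    by rewrite ler_wpM2l ?lerDl// mulr_ge0// ltW.
  by rewrite mulrAC mulrC -ler_pdivlMr// mulr_gt0.
have main : `|y k - one_step (u 0%N) (u k) (y 0%N)| <=
      kappa * eps * (phi (u k) - phi (u 0%N)) `^ (alpha * 3) * (`|y 0%N| + delta).
  apply: (@sewing_on R _ one_step (fun x => `|x| + delta) phi T (u 0%N) (u k) eta eps
    (kappa * eps) (alpha * 3) u y k) => //.
  - exact: ltW.
  - exact: ltW.
  - by rewrite ler_peMl// ltW.
  - exact: hk (ltW eps0).
  - by move=> x; rewrite addr_ge0.
  - move=> x x'; have := ler_normD (x - x') x'; rewrite subrK; lra.
  - by move=> s x /andP[us su]; apply: (one_step_id); rewrite (le_trans u0 us)/= (le_trans su).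
  - move=> s t x us st tu; have := growth s t x us st tu.
    have : 0 <= eta * delta by rewrite mulr_ge0// ltW.
    lra.
  - by move=> s t x x' us st tu; rewrite -one_stepB; exact: growth.
  - move=> s r t x us sr rt tu.
    have sth : t - s <= h by apply: le_trans ukh; apply: sub.
    have e01 : 0 <= e <= 1 by rewrite e1 ltW.
    have := one_step_defect x e01 sc (le_trans u0 us) sr rt (le_trans tu ukT) sth.
    move=> /le_trans; apply; rewrite (control_powX _ _ 3).
    apply: ler_pM => //.
    + exact: mulr_ge0 (mulr_ge0 (ltW D10) (exprn_ge0 _ (ltW e0))) (exprn_ge0 _ (powR_ge0 _ _)).
    + by rewrite ler_wpM2r// exprn_ge0// powR_ge0.
    + by rewrite lerDl.
split => //.
have uk : u 0%N <= u k by apply: umon; rewrite leqnn.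
have := growth (u 0%N) (u k) (y 0%N) (lexx _) uk (lexx _).
have : `|y k - one_step (u 0%N) (u k) (y 0%N)| <= eta * (`|y 0%N| + delta).
  apply: (le_trans main); rewrite ler_wpM2r ?addr_ge0// (le_trans _ kW)//.
  rewrite ler_wpM2l ?mulr_ge0 ?(ltW kap0) ?(ltW eps0)//.
  by apply: (powR_subadd cphi) => //; exact: ltW.
have := ler_normD (y k - one_step (u 0%N) (u k) (y 0%N)) (one_step (u 0%N) (u k) (y 0%N)); rewrite subrK.
have : eta * (`|y 0%N| + delta) <= 1 / 2 * (`|y 0%N| + delta).
  by rewrite ler_wpM2r ?addr_ge0.
have : eta * `|y 0%N| <= 1 / 2 * `|y 0%N| by rewrite ler_wpM2r.
lra.
Qed.

Hypothesis T0 : 0 <= T.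

(** The time 0 is added to every grid; repetitions are harmless because the
    one-step map over a point is the identity. *)
Definition grid_seq F := 0 :: sort <=%R [seq t <- F | 0 <= t <= T].

Definition grid F k := nth T (grid_seq F) k.

Lemma mem_grid F t : t \in F -> 0 <= t <= T -> t \in grid_seq F.
Proof. by move=> tF tT; rewrite inE mem_sort mem_filter tF tT orbT. Qed.

Lemma grid_bounds F k : 0 <= grid F k <= T.
Proof.
rewrite /grid; have [kF|Fk] := ltnP k (size (grid_seq F)); last by rewrite nth_default// T0 lexx.
have := mem_nth T kF; rewrite inE => /predU1P[->|]; first by rewrite lexx T0.
by rewrite mem_sort mem_filter => /andP[].
Qed.

Lemma grid_mono F i j : (i <= j)%N -> grid F i <= grid F j.
Proof.
move=> ij; have [jF|Fj] := ltnP j (size (grid_seq F)); last first.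
  by rewrite [leRHS]nth_default//; have /andP[] := grid_bounds F i.
apply: (sorted_leq_nth le_trans le_refl) => //; last first.
  by rewrite inE (leq_ltn_trans ij).
rewrite /grid_seq /= path_min_sorted; first exact: sort_le_sorted.
by apply/allP => t; rewrite mem_sort mem_filter => /andP[/andP[]].
Qed.

Lemma grid_index F t : t \in grid_seq F -> grid F (index t (grid_seq F)) = t.
Proof. exact: nth_index. Qed.

Fixpoint euler F (v : 'cV[R]_n) k :=
  if k is j.+1 then one_step (grid F j) (grid F k) (euler F v j) else v.

Definition euler_at F v t := euler F v (index t (grid_seq F)).

Lemma euler_at0 F v : euler_at F v 0 = v.
Proof. by rewrite /euler_at /grid_seq /= eqxx. Qed.

Lemma euler_estimate : exists (kappa eps0 : R), [/\ 1 <= kappa, 0 < eps0 &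
  forall eps : R, 0 < eps -> eps <= eps0 -> exists2 h : R, 0 < h &
  (forall s t x, 0 <= s -> s <= t -> t <= T -> t - s <= h -> `|one_step s t x| <= 2 * `|x|) /\
  forall F v s t, s \in grid_seq F -> t \in grid_seq F -> s <= t -> t - s <= h ->
    `|euler_at F v t - one_step s t (euler_at F v s)| <=
      kappa * eps * (phi t - phi s) `^ (alpha * 3) * `|euler_at F v s|
    /\ `|euler_at F v t| <= 2 * `|euler_at F v s|].
Proof.
have [kappa [eps0 [k1 e0 est]]] := flow_estimate.
exists kappa, eps0; split => // eps eps1 eps2.
have [h h0 hh] := est eps eps1 eps2; exists h => //; split.
  move=> s t x s0 st tT sth.
  pose u (i : nat) := if i is 0%N then s else t.
  pose y (i : nat) := if i is 0%N then x else one_step s t x.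
  have [||||||_] := hh 0 u y 1%N; rewrite ?addr0//.
  - by case=> [|i] [|j] /andP[]//=.
  - by case=> // _; rewrite /= subrr normr0 addr0 !mulr_ge0 ?powR_ge0// ltW.
move=> F v s t sF tF st sth.
set i := index s (grid_seq F); set j := index t (grid_seq F).
have gi : grid F i = s by exact: grid_index.
have gj : grid F j = t by exact: grid_index.
have ij : (i <= j)%N.
  rewrite leqNgt; apply/negP => ji.
  have := grid_mono F (ltnW ji); rewrite gi gj => ts.
  by move: ji; rewrite /i /j (@le_anti _ _ s t) ?ltnn// st.
have [||||||] := hh 0 (fun k => grid F (i + k)%N) (fun k => euler F v (i + k)%N) (j - i)%N;
  rewrite ?addn0 ?subnKC ?gi ?gj ?addr0//.
- by move=> a b /andP[ab _]; rewrite grid_mono// leq_add2l.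
- by have := grid_bounds F i; rewrite gi => /andP[].
- by have := grid_bounds F j; rewrite gj => /andP[].
- by move=> k _; rewrite addnS /= subrr normr0 addr0 !mulr_ge0 ?powR_ge0// ltW.
Qed.

(** Boundedness at [t] needs a chain of times from 0 to [t] with gaps at most [h0];
    such a chain is a finite set, so it belongs to all large grids.  Only the grids
    that contain [s] and [t] matter for the expansion over [s, t], and these are
    again all large grids. *)
Lemma euler_limit (v : 'cV[R]_n) : exists V : R -> 'cV[R]_n,
  [/\ V 0 = v, exists2 M : R, 0 <= M & forall t, 0 <= t <= T -> `|V t| <= M
  & forall e, 0 < e -> exists2 h : R, 0 < h & forall s t, 0 <= s -> s <= t ->
      t <= T -> t - s <= h ->
      `|V t - one_step s t (V s)| <= e * (phi t - phi s) `^ (alpha * 3)].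
Proof.
have [kappa [eps0 [k1 e0 est]]] := euler_estimate.
have [h0 h00 [_ hh0]] := est eps0 e0 (lexx _).
have bound (k : nat) t : 0 <= t <= T -> t <= k%:R * h0 ->
    exists F0 : seq R, forall F, {subset F0 <= F} -> t \in grid_seq F /\
      `|euler_at F v t| <= 2 ^+ k * `|v|.
  elim: k t => [|k IH] t /andP[t0 tT].
    rewrite mul0r => t0'; exists [::] => F _; have -> : t = 0 by apply: le_anti; rewrite t0 t0'.
    by rewrite euler_at0 expr0 mul1r mem_head.
  move=> tk; pose s := Num.max 0 (t - h0).
  have st : s <= t by rewrite ge_max t0 gerBl ltW.
  have s0 : 0 <= s by rewrite le_max lexx.
  have [||F0 hF0] := IH s.
  - by rewrite s0 (le_trans st).
  - rewrite ge_max mulr_ge0 ?(ltW h00)//=; move: tk; rewrite -natr1 mulrDl mul1r; lra.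
  exists (t :: F0) => F sF.
  have [sg sb] := hF0 F (fun z zF => sF z (mem_behead (zF : z \in behead (t :: F0)))).
  have tg : t \in grid_seq F by rewrite mem_grid ?t0// sF// mem_head.
  split => //; have sth : t - s <= h0 by rewrite lerBlDr -lerBlDl le_max lexx orbT.
  have [_] := hh0 F v s t sg tg st sth.
  move=> /le_trans; apply; rewrite exprS -mulrA ler_wpM2l//.
have [k hk] := nat_mul_ge T h00.
pose M := 2 ^+ k * `|v|.
have M0 : 0 <= M by rewrite mulr_ge0 ?exprn_ge0.
have bnd t : 0 <= t <= T -> exists F0 : seq R, forall F, {subset F0 <= F} ->
    t \in grid_seq F /\ `|euler_at F v t| <= M.
  by move=> t0T; apply: bound => //; case/andP: t0T => _ /le_trans; apply.
have [|V hV] := @finite_approx_limit R n [set t | 0 <= t <= T] (fun F t => euler_at F v t).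
  by move=> t /bnd[F0 hF0]; exists M, F0 => F /hF0[].
have VM t : 0 <= t <= T -> `|V t| <= M + 1.
  move=> t0T; have [F0 hF0] := bnd t t0T.
  have [F sF hF] := hV 1 [:: t] F0 ltr01 ltac:(by move=> z; rewrite inE => /eqP->).
  have := hF t (mem_head _ _); have [_ +] := hF0 F sF.
  rewrite distrC; have := ler_normD (V t - euler_at F v t) (euler_at F v t).
  rewrite subrK; lra.
exists V; split.
- apply/eqP; rewrite -subr_eq0 -normr_eq0 eq_le normr_ge0 andbT.
  apply/ler_addgt0Pl => e e_gt0; rewrite addr0 distrC.
  have [F _ hF] := hV e [:: 0] [::] e_gt0 ltac:(by move=> z; rewrite inE => /eqP-> /=; rewrite lexx T0).
  by have := hF 0 (mem_head _ _); rewrite euler_at0.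
- by exists (M + 1) => //; rewrite addr_ge0.
move=> e e_gt0.
have kM : 0 < kappa * (M + 2) by rewrite mulr_gt0//; lra.
pose e1 := Num.min eps0 (e / (kappa * (M + 2))).
have e10 : 0 < e1 by rewrite lt_min e0 divr_gt0.
have e11 : e1 <= eps0 by rewrite ge_min lexx.
have [h h_gt0 [growth hh]] := est e1 e10 e11.
exists h => // s t s0 st tT sth.
have s0T : 0 <= s <= T by rewrite s0 (le_trans st).
have t0T : 0 <= t <= T by rewrite (le_trans s0 st).
have [Fs hFs] := bnd s s0T; have [Ft hFt] := bnd t t0T.
set w := _ `^ _; have w0 : 0 <= w by exact: powR_ge0.
apply/ler_addgt0Pr => g g0.
pose g' := Num.min 1 (g / 3).
have g'0 : 0 < g' by rewrite lt_min ltr01 divr_gt0.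
have g3 : g' + 2 * g' <= g.
  have : g' <= g / 3 by rewrite ge_min lexx orbT.
  lra.
have [F sF hF] := hV g' [:: s; t] (Fs ++ Ft) g'0
  ltac:(by move=> z; rewrite !inE => /orP[]/eqP->).
have [sg _] := hFs F (fun z zF => sF z ltac:(by rewrite mem_cat zF)).
have [tg _] := hFt F (fun z zF => sF z ltac:(by rewrite mem_cat zF orbT)).
have as_ := hF s (mem_head _ _).
have at_ := hF t ltac:(by rewrite !inE eqxx orbT).
have [est1 _] := hh F v s t sg tg st sth.
have est2 := growth s t (euler_at F v s - V s) s0 st tT sth.
move: est2; rewrite one_stepB => est2.
have vs : `|euler_at F v s| <= M + 2.
  have := ler_normD (euler_at F v s - V s) (V s); rewrite subrK.
  have := VM s s0T; have : g' <= 1 by rewrite ge_min lexx.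
  lra.
have main : kappa * e1 * w * `|euler_at F v s| <= e * w.
  apply: (@le_trans _ _ (kappa * e1 * w * (M + 2))).
    apply: ler_wpM2l vs.
    exact: mulr_ge0 (mulr_ge0 (le_trans ler01 k1) (ltW e10)) w0.
  have -> : kappa * e1 * w * (M + 2) = e1 * (kappa * (M + 2)) * w by ring.
  by rewrite ler_wpM2r// -ler_pdivlMr// ge_min lexx orbT.
have -> : V t - one_step s t (V s) = - (euler_at F v t - V t)
  + (euler_at F v t - one_step s t (euler_at F v s)) + (one_step s t (euler_at F v s) - one_step s t (V s)).
  have gen (x1 x2 x3 x4 : 'cV[R]_n) :
    x1 - x4 = - (x2 - x1) + (x2 - x3) + (x3 - x4).
    by rewrite opprB !addrA !subrK.
  exact: gen.
apply: (le_trans (ler_normD _ _)).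
apply: (le_trans (lerD (ler_normD _ _) (lexx _))).
rewrite normrN.
have est3 := le_trans est2 (ler_wpM2l (ler0n _ 2) as_).
apply: (le_trans (lerD (lerD at_ (le_trans est1 main)) est3)).
by rewrite addrAC addrC lerD2l.
Qed.

(** A path that starts at 0 and follows the one-step maps up to a little-o error
    follows them, along a sufficiently fine subdivision, up to an error proportional
    to the size [|x| + delta]; by [flow_estimate] it stays below
    [2 * delta], for every [delta]. *)
Lemma flow_unique (E : R -> 'cV[R]_n) : E 0 = 0 ->
  (forall e, 0 < e -> exists2 h : R, 0 < h & forall s t, 0 <= s -> s <= t ->
      t <= T -> t - s <= h ->
      `|E t - one_step s t (E s)| <= e * (phi t - phi s) `^ (alpha * 3)) ->
  forall t, 0 <= t <= T -> E t = 0.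
Proof.
move=> E0 hE.
have [kappa [eps0 [k1 e0 est]]] := flow_estimate.
have [h0 h00 hh] := est eps0 e0 (lexx _).
have step s t : 0 <= s -> s <= t -> t <= T -> t - s <= h0 -> E s = 0 -> E t = 0.
  move=> s0 st tT sth Es.
  apply/eqP; rewrite -normr_eq0 eq_le normr_ge0 andbT.
  apply/ler_addgt0Pl => e e_gt0; rewrite addr0.
  pose delta := e / 2; have delta0 : 0 < delta by rewrite divr_gt0.
  have [h h_gt0 hEh] := hE (eps0 * delta) (mulr_gt0 e0 delta0).
  have [m hm] := nat_mul_ge (t - s) h_gt0.
  have ts0 : 0 <= t - s by rewrite subr_ge0.
  pose u (i : nat) := s + (t - s) * (i%:R / m.+1%:R).
  have u0 : u 0%N = s by rewrite /u mul0r mulr0 addr0.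
  have um : u m.+1 = t by rewrite /u divff ?pnatr_eq0// mulr1 addrC subrK.
  have umon i j : (i <= j)%N -> u i <= u j.
    by move=> ij; rewrite lerD2l ler_wpM2l// ler_wpM2r ?invr_ge0// ler_nat.
  have ustep i : u i.+1 - u i <= h.
    rewrite /u opprD addrACA subrr add0r -mulrBr -mulrBl.
    have -> : i.+1%:R - i%:R = 1 :> R by rewrite -natr1 addrAC subrr add0r.
    rewrite mul1r.
    rewrite ler_pdivrMr ?ltr0n//; apply: (le_trans hm); rewrite mulrC ler_wpM2l ?(ltW h_gt0)//.
    by rewrite ler_nat.
  have [||||||_] := hh delta u (E \o u) m.+1; rewrite /= ?u0 ?um//.
  - exact: ltW.
  - by move=> i j /andP[ij _]; exact: umon.
  - move=> i im.
    have ui : 0 <= u i by apply: (le_trans s0); rewrite -u0; exact: umon.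
    have uT : u i.+1 <= T by apply: le_trans tT; rewrite -um; exact: umon.
    apply: (le_trans (hEh _ _ ui (umon _ _ (leqnSn i)) uT (ustep i))).
    rewrite mulrAC ler_wpM2l ?mulr_ge0 ?powR_ge0 ?(ltW e0)//.
    by rewrite lerDr.
  by rewrite Es normr0 add0r /delta => /le_trans; apply; lra.
have all_t (k : nat) t : 0 <= t <= T -> t <= k%:R * h0 -> E t = 0.
  elim: k t => [|k IH] t /andP[t0 tT].
    by rewrite mul0r => t0'; have -> : t = 0 by apply: le_anti; rewrite t0 t0'.
  move=> tk; pose s := Num.max 0 (t - h0).
  have st : s <= t by rewrite ge_max t0 gerBl ltW.
  have s0 : 0 <= s by rewrite le_max lexx.
  apply: (step s) => //; first by rewrite lerBlDr -lerBlDl le_max lexx orbT.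
  apply: IH; first by rewrite s0 (le_trans st).
  by rewrite ge_max mulr_ge0 ?(ltW h00)//=; move: tk; rewrite -natr1 mulrDl mul1r; lra.
have [k hk] := nat_mul_ge T h00.
move=> t t0T; apply: (all_t k) => //.
by case/andP: t0T => _ /le_trans; apply.
Qed.

End flow.

(** * The drift *)

Section drift_estimate.
Context {R : realType} {n : nat}.
Local Notation mu := (@lebesgue_measure R).
Variable T : R.

Lemma aeS (P Q : R -> Prop) : (forall x, P x -> Q x) ->
  {ae mu, forall x, P x} -> {ae mu, forall x, Q x}.
Proof. by move=> PQ; apply: (@filterS _ _ (ae_filter_ringOfSetsType mu)). Qed.

Lemma ae_ord (P : 'I_n -> R -> Prop) : (forall i, {ae mu, forall x, P i x}) ->
  {ae mu, forall x, forall i, P i x}.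
Proof. by move=> h; apply: (@filter_forall _ _ _ _ (ae_filter_ringOfSetsType mu)). Qed.

(** Truncating at the essential supremum changes [f] on a negligible set only, and
    leaves a measurable function that is bounded everywhere. *)
Lemma Linfty_truncation (f : R -> R) :
  (f \_ `[0, T]) \in Lfun mu +oo%E ->
  exists M (g : R -> R), [/\ 0 <= M, measurable_fun setT g /\ measurable_fun `[0, T] f,
    forall x, `|g x| <= M & {ae mu, forall x, `[0, T]%classic x -> f x = g x}].
Proof.
set F := f \_ `[0, T]; move=> /andP[]; rewrite inE => mf; rewrite /finLfun inE /finite_norm unlock /=.
have -> : (0 < mu [set: R])%E.
  by rewrite -set_itvNyy lebesgue_measure_itv /= addye.
move=> fty; pose M : R := `|fine (ess_sup mu (abse \o (EFin \o F)))|.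
exists M, ((F \max cst (- M)) \min cst M).
have M0 : 0 <= M by exact: normr_ge0.
split => //.
- split; first by apply: measurable_minr => //; apply: measurable_maxr.
  by apply/measurable_restrictT.
- move=> x /=; rewrite ler_norml ge_min lexx orbT andbT le_min le_max lexx orbT /=.
  by rewrite (@le_trans _ _ 0)// oppr_le0.
have : {ae mu, forall x, (`|F x|%:E <= M%:E)%E}.
  have := ess_sup_ge mu (abse \o (EFin \o F)).
  have eM : (ess_sup mu (abse \o (EFin \o F)) <= M%:E)%E.
    rewrite /M; move: fty; case: (ess_sup _ _) => [r _|//|_]; last by rewrite leNye.
    by rewrite lee_fin /= ler_norm.
  by apply: aeS => x /= h; exact: le_trans eM.
apply: aeS => x + xT; have Fx : F x = f x by rewrite /F patchE mem_set.
rewrite /= Fx lee_fin ler_norml => /andP[fM1 fM2].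
by rewrite max_l// min_l.
Qed.

Lemma within_measurable (V : R -> 'cV[R]_n) :
  {within `[0, T], continuous V} -> forall j, measurable_fun `[0, T] (fun s => V s j 0).
Proof.
move=> Vc j; apply: subspace_continuous_measurable_fun => //.
apply: unif0_continuous => e e0; have [h h0 hh] := continuous_unif0 Vc e0.
exists h => // s t s0 st tT sth; apply: le_trans (hh s t s0 st tT sth).
by have := mx_entry_le (increment V s t) j 0; rewrite /increment mxE mxE.
Qed.

Lemma bounded_integrable (f : R -> R) (K a b : R) (x y : bool) :
  measurable_fun [set` Interval (BSide x a) (BSide y b)] f ->
  (forall r, r \in Interval (BSide x a) (BSide y b) -> `|f r| <= K) ->
  mu.-integrable [set` Interval (BSide x a) (BSide y b)] (EFin \o f).
Proof.
move=> mf fK; apply: measurable_bounded_integrable => //.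
  by rewrite /= lebesgue_measure_itv /=; case: ifP => // _; rewrite -?EFinB ltry.
exists K; split; first exact: num_real.
by move=> z Kz r rI; apply: le_trans (fK r rI) _; exact: ltW.
Qed.

Lemma Rintegral_sum (D : set R) (f : 'I_n -> R -> R) : measurable D ->
  (forall j, mu.-integrable D (EFin \o f j)) ->
  \int[mu]_(x in D) (\sum_j f j x) = \sum_j \int[mu]_(x in D) f j x.
Proof.
move=> mD fi; rewrite /Rintegral.
under eq_integral do rewrite -sumEFin.
rewrite integral_sum// -sum_fine// => j _.
exact: (@integrable_fin_num _ _ _ mu D mD _ (fi j)).
Qed.

(** With [B s t] the integral of [A] over [s, t], freezing [V] at [s] in the drift costs the
    oscillation of [V] over [s, t] times [t - s]. *)
Lemma drift_linearization (A : R -> 'M[R]_n) : 0 <= T -> Linfty T A ->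
  exists M (B : R -> R -> 'M[R]_n), [/\ 0 <= M,
    forall s r t, B s t = B s r + B r t,
    forall s t : R, 0 <= s -> s <= t -> t <= T -> `|B s t| <= M * (t - s)
  & forall (V : R -> 'cV[R]_n) (s t w : R), {within `[0, T], continuous V} ->
    0 <= s -> s <= t -> t <= T ->
    (forall r : R, s <= r <= t -> `|V r - V s| <= w) ->
    `|drift A V t - drift A V s - B s t *m V s| <= M * w * (t - s)].
Proof.
move=> T0 hA.
have /choice[Mf hMf] : forall ij : 'I_n * 'I_n, exists Mg : R * (R -> R),
    [/\ 0 <= Mg.1, measurable_fun setT Mg.2
          /\ measurable_fun `[0, T] (fun s => A s ij.1 ij.2), forall x, `|Mg.2 x| <= Mg.1
    & {ae mu, forall x, `[0, T]%classic x -> A x ij.1 ij.2 = Mg.2 x}].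
  by move=> [i j]; have [M [g h]] := Linfty_truncation (hA i j); exists (M, g).
pose g i j := (Mf (i, j)).2.
pose M1 := \sum_(ij : 'I_n * 'I_n) (Mf ij).1.
have M10 : 0 <= M1 by apply: sumr_ge0 => ij _; have [] := hMf ij.
have gM i j x : `|g i j x| <= M1.
  have [_ _ h _] := hMf (i, j); apply: (le_trans (h x)).
  rewrite /M1 (bigD1 (i, j))//= lerDl sumr_ge0// => ij _.
  by have [] := hMf ij.
have mg i j (D : set R) : measurable D -> measurable_fun D (g i j).
  by move=> mD; apply: measurable_funS measurableT _ _ => //; have [_ []] := hMf (i, j).
have mA i j : measurable_fun `[0, T] (fun s => A s i j) by have [_ []] := hMf (i, j).
pose I (f : R -> R) t := \int[mu]_(x in `[0, t]) f x.
pose B s t : 'M[R]_n := \matrix_(i, j) (I (g i j) t - I (g i j) s).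
(* additivity of the integral over [0, t] = [0, s] + ]s, t] *)
have Isub (f : R -> R) (s t : R) : 0 <= s -> s <= t -> mu.-integrable `[0, t] (EFin \o f) ->
    I f t - I f s = \int[mu]_(x in `]s, t]) f x.
  by move=> s0 st fi; apply: Rintegral_itvB => //; rewrite bnd_simp.
have Ible (f : R -> R) (s t K : R) : 0 <= s -> s <= t -> measurable_fun `]s, t] f ->
    (forall r : R, s < r <= t -> `|f r| <= K) ->
    `|\int[mu]_(x in `]s, t]) f x| <= K * (t - s).
  move=> s0 st mf fK.
  have fi : mu.-integrable `]s, t] (EFin \o f).
    by apply: (bounded_integrable (K := K)) => // r; rewrite in_itv /=; exact: fK.
  apply: (le_trans (le_normr_Rintegral _ fi)) => //.
  apply: (@le_trans _ _ (\int[mu]_(x in `]s, t]) (cst K x))).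
    apply: le_Rintegral => //; first exact: integrable_norm.
    by apply: (bounded_integrable (K := `|K|)).
  rewrite Rintegral_cst//= lebesgue_measure_itv /= lte_fin.
  have [st'|ts] := ltP s t; first by rewrite -EFinD.
  have -> : s = t by apply: le_anti; rewrite st ts.
  by rewrite subrr.
have gi i j t : mu.-integrable `[0, t] (EFin \o g i j).
  by apply: (bounded_integrable (K := M1)) => //; exact: mg.
exists (n%:R * M1 + M1), B; split.
- by rewrite addr_ge0// mulr_ge0.
- by move=> s r t; apply/matrixP => i j; rewrite !mxE addrC subrKA.
- move=> s t s0 st tT; apply: mx_norm_le => [|i j].
    by rewrite mulr_ge0 ?subr_ge0// addr_ge0// mulr_ge0.
  rewrite mxE Isub//; apply: (@le_trans _ _ (M1 * (t - s))).
    by apply: Ible => //; exact: mg.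
  by rewrite ler_wpM2r ?subr_ge0// lerDr mulr_ge0.
move=> V s t w Vc s0 st tT Vw.
have w0 : 0 <= w by apply: le_trans (Vw s _); rewrite // lexx st.
have mV := within_measurable Vc.
have [MV MV0 hMV] := continuous_norm_bounded Vc.
have sub0 t' : t' <= T -> `[0, t']%classic `<=` (`[0, T]%classic : set R).
  by move=> t'T x /=; rewrite !in_itv /= => /andP[-> /le_trans]; apply.
have mgV i j (D : set R) : measurable D -> D `<=` `[0, T]%classic ->
    measurable_fun D (fun x => g i j x * V x j 0).
  move=> mD DT; apply: measurable_funM; first exact: mg.
  by apply: measurable_funS (mV j).
have gVi i j t' : t' <= T -> mu.-integrable `[0, t'] (EFin \o (fun x => g i j x * V x j 0)).
  move=> t'T; apply: (bounded_integrable (K := M1 * MV)).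
    by apply: mgV => //; exact: sub0.
  move=> r; rewrite in_itv /= => /andP[r0 rt]; rewrite normrM ler_pM//.
  by apply: (le_trans (mx_entry_le _ _ _)); apply: hMV; rewrite r0 (le_trans rt).
have driftE t' i : 0 <= t' -> t' <= T ->
    drift A V t' i 0 = \sum_j I (fun x => g i j x * V x j 0) t'.
  move=> t'0 t'T; rewrite mxE.
  have -> : \int[mu]_(x in `[0, t']) (A x *m V x) i 0 =
            \int[mu]_(x in `[0, t']) (\sum_j g i j x * V x j 0).
    rewrite /Rintegral; congr fine; apply: ae_eq_integral => //.
    - apply/measurable_EFinP.
      have -> : (fun x => (A x *m V x) i 0) = (fun x => \sum_j A x i j * V x j 0).
        by apply/funext => x; rewrite mxE.
      apply: measurable_sum => j; apply: measurable_funM; last exact: measurable_funS (sub0 _ t'T) (mV j).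
      exact: measurable_funS (sub0 _ t'T) (mA i j).
    - apply/measurable_EFinP; apply: measurable_sum => j.
      by apply: mgV => //; exact: sub0.
    have : {ae mu, forall x, forall j, `[0, T]%classic x -> A x i j = g i j x}.
      by apply: ae_ord => j; have [] := hMf (i, j).
    apply: aeS => x h xt /=; congr EFin; rewrite mxE; apply: eq_bigr => j _.
    by rewrite h//; exact: sub0 xt.
  by rewrite Rintegral_sum// => j; exact: gVi.
apply: mx_norm_le => [|i z].
  by rewrite !mulr_ge0 ?subr_ge0// addr_ge0// mulr_ge0.
rewrite (ord1 z) !(mx_addE, mx_oppE) !driftE ?(le_trans st)//; last exact: le_trans st.
rewrite [(B s t *m V s) i 0]mxE -!sumrB.
apply: (@le_trans _ _ (n%:R * (M1 * w * (t - s)))); last first.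
  rewrite !mulrA ler_wpM2r ?subr_ge0// ler_wpM2r// lerDl//.
apply: norm_sum_ord => j.
rewrite mxE (Isub _ _ _ s0 st (gVi i j t tT)) (Isub _ _ _ s0 st (gi i j t)).
have dT : `]s, t]%classic `<=` (`[0, T]%classic : set R).
  by move=> x /=; rewrite !in_itv /= => /andP[sx xt]; rewrite (le_trans s0 (ltW sx)) (le_trans xt).
have d0t : `]s, t]%classic `<=` (`[0, t]%classic : set R).
  by move=> x /=; rewrite !in_itv /= => /andP[sx xt]; rewrite (le_trans s0 (ltW sx)).
have gi' : mu.-integrable `]s, t] (EFin \o g i j) by apply: integrableS (gi i j t).
have gVi' : mu.-integrable `]s, t] (EFin \o (fun x => g i j x * V x j 0)).
  by apply: integrableS (gVi i j t tT).
rewrite -RintegralZr// -RintegralB//; last first.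
  apply: (bounded_integrable (K := M1 * MV)).
    by apply: measurable_funM => //; exact: mg.
  move=> r _; rewrite normrM ler_pM//.
  by apply: (le_trans (mx_entry_le _ _ _)); apply: hMV; rewrite s0 (le_trans st).
apply: Ible => //.
  apply: measurable_funB; first exact: mgV.
  by apply: measurable_funM => //; exact: mg.
move=> r /andP[sr rt]; rewrite -mulrBr normrM ler_pM//.
have := Vw r; rewrite (ltW sr) rt => /(_ isT); apply: le_trans.
by have := mx_entry_le (V r - V s) j 0; rewrite !mxE.
Qed.

End drift_estimate.

(** * The data of the equation as a driver *)

Section driver_construction.
Context {R : realType}.
Implicit Types (p T alpha : R).

Lemma exponent_choice p : 2 <= p < 3 -> exists alpha : R,
  [/\ 0 < alpha, 1 < alpha * 3, alpha * p < 1 & alpha * 2 < 1].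
Proof.
move=> /andP[p2 p3]; have p0 : 0 < p by lra.
exists ((3^-1 + p^-1) / 2).
have h1 : 3^-1 < p^-1 by rewrite ltf_pV2 ?posrE.
have h2 : p^-1 <= 2^-1 by rewrite lef_pV2 ?posrE.
have h3 : p^-1 * p = 1 by rewrite mulVf// gt_eqF.
by split; lra.
Qed.

Lemma remainder_unif0 {m d : nat} T (X : R -> 'cV[R]_d) (Y : R -> 'cV[R]_m)
    (Yd : R -> 'M[R]_(m, d)) :
  {within `[0, T], continuous X} -> {within `[0, T], continuous Y} ->
  {within `[0, T], continuous Yd} -> unif0 T (remainder X Y Yd).
Proof.
move=> Xc Yc Ydc e e0.
have [M M0 hM] := continuous_norm_bounded Ydc.
pose c : R := @bilin_const R m d * M + 1.
have c0 : 0 < c by rewrite ltr_wpDl// mulr_ge0// bilin_const_ge0.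
have [h1 h10 hh1] := continuous_unif0 Yc (divr_gt0 e0 (ltr0n _ 2)).
have [h2 h20 hh2] := continuous_unif0 Xc (divr_gt0 (divr_gt0 e0 (ltr0n _ 2)) c0).
exists (Num.min h1 h2); first by rewrite lt_min h10.
move=> s t s0 st tT; rewrite le_min => /andP[d1 d2].
apply: (le_trans (ler_normB _ _)).
have b1 := hh1 s t s0 st tT d1; have b2 := hh2 s t s0 st tT d2.
have b3 : `|Yd s *m increment X s t| <= e / 2.
  apply: (le_trans (norm_mulmx_nd _ _)).
  apply: (@le_trans _ _ (c * (e / 2 / c))); last by rewrite mulrC divfK// gt_eqF.
  apply: ler_pM => //; first by rewrite mulr_ge0// bilin_const_ge0.
  apply: (@le_trans _ _ (@bilin_const R m d * M)); last by rewrite /c lerDl.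
  by rewrite ler_wpM2l ?bilin_const_ge0// hM// s0 (le_trans st).
lra.
Qed.

Lemma outer_mxE {d : nat} (a b : 'cV[R]_d) i j : (a *m b^T) i j = a i 0 * b j 0.
Proof. by rewrite mxE big_ord1 mxE. Qed.

Lemma chen_mx {d : nat} p T (X : R -> 'cV[R]_d) (XX : R -> R -> 'M[R]_d) :
  rough_path p T X XX -> forall s r t, 0 <= s <= T -> 0 <= r <= T -> 0 <= t <= T ->
  XX s t = XX s r + XX r t + increment X s r *m (increment X r t)^T.
Proof.
move=> [_ _ _ chen] s r t sT rT tT; apply/matrixP => i j.
rewrite (chen s r t) ?in_itv//= [RHS]mx_addE outer_mxE.
by rewrite [(XX s r + XX r t) i j]mx_addE.
Qed.

Lemma chen_diag {d : nat} p T (X : R -> 'cV[R]_d) (XX : R -> R -> 'M[R]_d) :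
  rough_path p T X XX -> forall s, 0 <= s <= T -> XX s s = 0.
Proof.
move=> hX s sT; have := chen_mx hX sT sT sT.
rewrite /increment subrr mul0mx addr0 => /esym/eqP.
by rewrite -subr_eq0 addrK => /eqP.
Qed.

(** The control is the sum of those of all the data.  The additional [phi0] allows it
    to dominate the control of a given solution too. *)
Lemma driver_of {n d : nat} p T alpha (X : R -> 'cV[R]_d) (XX : R -> R -> 'M[R]_d)
    (Sigma : R -> 'cV[R]_(n * d * n)) (Sigma' : R -> 'M[R]_(n * d * n, d))
    (B : R -> R -> 'M[R]_n) (M : R) (phi0 : R -> R) :
  2 <= p < 3 -> 0 < alpha -> 1 < alpha * 3 -> alpha * p < 1 -> alpha * 2 < 1 ->
  rough_path p T X XX -> controlled_path p T X Sigma Sigma' ->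
  (forall s r t, B s t = B s r + B r t) ->
  (forall s t, 0 <= s -> s <= t -> t <= T -> `|B s t| <= M * (t - s)) ->
  (forall s t, 0 <= s -> s < t -> t <= T -> 0 <= phi0 t - phi0 s) ->
  exists phi C, driver T phi alpha C X XX Sigma Sigma' B /\
    [/\ forall s t, 0 <= s -> s < t -> t <= T -> phi0 t - phi0 s <= phi t - phi s,
      controls T phi p (increment X), controls T phi p (increment Sigma)
      & controls T phi (p / 2) XX].
Proof.
move=> /andP[p2 p3] a0 a3 ap a2 hX hS BD Ble phi0_ge0.
have p0 : 0 < p by lra.
have p20 : 0 < p / 2 by rewrite divr_gt0.
have [[Xc Xv] XXc XXv _] := hX.
have [[Sc Sv] [Sdc Sdv] Rv] := hS.
have [f1 c1] := finite_qvariation_controls p0 Xv.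
have [f2 c2] := finite_qvariation_controls p20 XXv.
have [f3 c3] := finite_qvariation_controls p0 Sv.
have [f4 c4] := finite_qvariation_controls p0 Sdv.
have [f5 c5] := finite_qvariation_controls p20 Rv.
pose phi t := f1 t + f2 t + f3 t + f4 t + f5 t + phi0 t + t.
have ge0 s t : 0 <= s -> s < t -> t <= T ->
   [/\ 0 <= f1 t - f1 s, 0 <= f2 t - f2 s, 0 <= f3 t - f3 s, 0 <= f4 t - f4 s & 0 <= f5 t - f5 s].
  move=> s0 st tT; split.
  - exact: le_trans (powR_ge0 _ _) (c1 s t s0 st tT).
  - exact: le_trans (powR_ge0 _ _) (c2 s t s0 st tT).
  - exact: le_trans (powR_ge0 _ _) (c3 s t s0 st tT).
  - exact: le_trans (powR_ge0 _ _) (c4 s t s0 st tT).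
  - exact: le_trans (powR_ge0 _ _) (c5 s t s0 st tT).
have dom s t : 0 <= s -> s < t -> t <= T ->
   [/\ f1 t - f1 s <= phi t - phi s, f2 t - f2 s <= phi t - phi s,
      f3 t - f3 s <= phi t - phi s, f4 t - f4 s <= phi t - phi s
     & f5 t - f5 s <= phi t - phi s] /\
   [/\ phi0 t - phi0 s <= phi t - phi s & t - s <= phi t - phi s].
  move=> s0 st tT; have [g1 g2 g3 g4 g5] := ge0 s t s0 st tT.
  have g0 := phi0_ge0 s t s0 st tT.
  by rewrite /phi; split; split; lra.
have cphi : is_control T phi.
  move=> s t s0; rewrite le_eqVlt => /predU1P[-> tT|st tT]; first by rewrite !subrr.
  by have [_ []] := dom s t s0 st tT.
have C1 : controls T phi p (increment X).
  by apply: (controls_le c1) => s t s0 st tT; have [[]] := dom s t s0 st tT.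
have C2 : controls T phi (p / 2) XX.
  by apply: (controls_le c2) => s t s0 st tT; have [[]] := dom s t s0 st tT.
have C3 : controls T phi p (increment Sigma).
  by apply: (controls_le c3) => s t s0 st tT; have [[]] := dom s t s0 st tT.
have C4 : controls T phi p (increment Sigma').
  by apply: (controls_le c4) => s t s0 st tT; have [[]] := dom s t s0 st tT.
have C5 : controls T phi (p / 2) (remainder X Sigma Sigma').
  by apply: (controls_le c5) => s t s0 st tT; have [[]] := dom s t s0 st tT.
have [M1 M10 hM1] := continuous_norm_bounded Sc.
have [M2 M20 hM2] := continuous_norm_bounded Sdc.
have a20 : 0 < alpha * 2 by rewrite mulr_gt0.
have a2p : alpha * 2 * (p / 2) < 1.
  by have -> : alpha * 2 * (p / 2) = alpha * p by field.
exists phi, (1 + M1 + M2 + (phi T - phi 0) `^ alpha); split; last first.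
  by split => // s t s0 st tT; have [_ []] := dom s t s0 st tT.
have W0 : 0 <= (phi T - phi 0) `^ alpha by exact: powR_ge0.
split => //.
- lra.
- lra.
- by move=> t /hM1; lra.
- by move=> t /hM2; lra.
- move=> s r t s0 sr rt tT; apply: (chen_mx hX).
  + by rewrite s0 (le_trans sr (le_trans rt tT)).
  + by rewrite (le_trans s0 sr) (le_trans rt tT).
  + by rewrite (le_trans s0 (le_trans sr rt)).
- exact: chen_diag hX.
- exact: controls_small (continuous_unif0 Xc) C1.
- exact: controls_small (continuous_unif0 Sc) C3.
- exact: controls_small (continuous_unif0 Sdc) C4.
- exact: controls_small (continuous2_unif0 XXc (chen_diag hX)) C2.
- exact: controls_small (remainder_unif0 Xc Sc Sdc) C5.
- apply: (@small_le R T phi _ R _ B (fun s t => t - s) M).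
    by move=> s t s0 st tT; rewrite ger0_norm ?subr_ge0//; exact: Ble.
  apply: (controls_small cphi ltr01) => //; first by rewrite mulr1.
    by move=> e e0; exists e => // s t s0 st tT; rewrite ger0_norm ?subr_ge0.
  move=> s t s0 st tT; rewrite powRr1// ger0_norm ?subr_ge0 ?(ltW st)//.
  by apply: cphi => //; exact: ltW.
Qed.

End driver_construction.

(** * Solutions and their expansion *)

Section solutions.
Context {R : realType} {n d : nat}.
Variables (p T : R) (phi : R -> R) (alpha C : R).
Variables (A : R -> 'M[R]_n) (X : R -> 'cV[R]_d) (XX : R -> R -> 'M[R]_d).
Variables (Sigma : R -> 'cV[R]_(n * d * n)) (Sigma' : R -> 'M[R]_(n * d * n, d)).
Variables (B : R -> R -> 'M[R]_n) (M : R).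
Hypothesis D : driver T phi alpha C X XX Sigma Sigma' B.
Hypothesis a2 : alpha * 2 < 1.
Hypothesis M0 : 0 <= M.
Hypothesis drift_lin : forall (V : R -> 'cV[R]_n) (s t w : R),
    {within `[0, T], continuous V} -> 0 <= s -> s <= t -> t <= T ->
    (forall r : R, s <= r <= t -> `|V r - V s| <= w) ->
    `|drift A V t - drift A V s - B s t *m V s| <= M * w * (t - s).
Implicit Types (e h s r t : R).
Local Notation P := (one_step X XX Sigma Sigma' B).
Local Notation bc := (@bilin_const R n d).

Let cphi := drv_control D.

Lemma time_small : small T phi (alpha * 2) (fun s t => t - s).
Proof.
have a20 : 0 < alpha * 2 by rewrite mulr_gt0// (drv_alpha D).
apply: (controls_small cphi ltr01) => //; first by rewrite mulr1.
  by move=> e e0; exists e => // s t s0 st tT; rewrite ger0_norm ?subr_ge0.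
move=> s t s0 st tT; rewrite powRr1// ger0_norm ?subr_ge0 ?(ltW st)//.
by apply: cphi => //; exact: ltW.
Qed.

Lemma drift_small (V : R -> 'cV[R]_n) : {within `[0, T], continuous V} ->
  small T phi alpha (increment V) ->
  small T phi (alpha * 3) (fun s t => drift A V t - drift A V s - B s t *m V s).
Proof.
move=> Vc Vs e e0; have M1 : 0 < M + 1 by rewrite ltr_wpDl.
have [h1 h10 hh1] := Vs 1 ltr01.
have [h2 h20 hh2] := time_small (divr_gt0 e0 M1).
exists (Num.min h1 h2); first by rewrite lt_min h10.
move=> s t s0 st tT; rewrite le_min => /andP[d1 d2].
have st2 := hh2 s t s0 st tT d2; move: st2; rewrite ger0_norm ?subr_ge0// => st2.
have Vw r : s <= r <= t -> `|V r - V s| <= (phi t - phi s) `^ alpha.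
  move=> /andP[sr rt]; have rT := le_trans rt tT.
  have rsh : r - s <= h1 by apply: le_trans d1; rewrite lerB.
  apply: (le_trans (hh1 s r s0 sr rT rsh)); rewrite mul1r.
  exact: (powR_subadd cphi (ltW (drv_alpha D))).
apply: (le_trans (drift_lin Vc s0 st tT Vw)).
move: st2; rewrite (control_powX _ _ _ _ 2) (control_powX _ _ _ _ 3).
set q := _ `^ alpha; have q0 : 0 <= q by exact: powR_ge0.
move=> st2; apply: (@le_trans _ _ (M * q * (e / (M + 1) * q ^+ 2))).
  by rewrite ler_wpM2l// mulr_ge0.
have -> : M * q * (e / (M + 1) * q ^+ 2) = M / (M + 1) * (e * q ^+ 3) by ring.
rewrite ler_piMl// ?mulr_ge0 ?exprn_ge0 ?(ltW e0)//.
by rewrite ler_pdivrMr// mul1r lerDl.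
Qed.

Lemma drift0 (V : R -> 'cV[R]_n) : drift A V 0 = 0.
Proof. by apply/matrixP => i j; rewrite !mxE set_itv1 Rintegral_set1. Qed.

Let Xi (V : R -> 'cV[R]_n) s t :=
  germ (Sigma s) (Sigma' s) (V s) (increment X s t) (XX s t).

Lemma one_step_germ (V : R -> 'cV[R]_n) s t :
  P s t (V s) = V s + B s t *m V s + Xi V s t.
Proof. by []. Qed.

Lemma rough_sum_germ (V : R -> 'cV[R]_n) (Vd : R -> 'M[R]_(n, d)) s t pi :
  (forall r, 0 <= r <= T -> Vd r = tensor_mul (Sigma r) (V r)) ->
  0 <= s -> t <= T -> itv_partition s t pi ->
  rough_sum X XX (fun r => tensor_mul (Sigma r) (V r))
    (fun r => tensor_mul_deriv (Sigma r) (Sigma' r) (V r) (Vd r)) s pi =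
  \sum_(uv <- subintervals s pi) Xi V uv.1 uv.2.
Proof.
move=> VdE s0 tT sp; apply: eq_big_seq => uv uvp.
have [u0 uv12 vt _] := subintervals_mem sp uvp.
rewrite VdE// (le_trans s0 u0)/=.
by rewrite (le_trans (ltW uv12))// (le_trans vt).
Qed.

(** The rough integral up to [t] is a limit along partitions of [0, t] only.  Choosing
    them through [s] shows that its increment over [s, t] is approximated by
    sums over partitions of [s, t], which additive sewing compares with the
    germ. *)
Lemma expansion_of_solution (v : 'cV[R]_n) (V : R -> 'cV[R]_n) (Vd : R -> 'M[R]_(n, d)) :
  is_solution p T v A X XX Sigma Sigma' V Vd ->
  small T phi alpha (increment V) -> small T phi (alpha * 2) (remainder X V Vd) ->
  small T phi (alpha * 3) (fun s t => V t - P s t (V s)).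
Proof.
move=> [[[Vc _] _ _] VdE sol] Vs Rs.
have {}VdE r : 0 <= r <= T -> Vd r = tensor_mul (Sigma r) (V r).
  by move=> rT; apply: VdE; rewrite /= in_itv.
have [Y Y0 hY] := continuous_norm_bounded Vc.
have c0 : 0 < (@bilin_const R n d) ^+ 3 * C ^+ 2 * (5 * Y + 4 * 1).
  have c1 := @bilin_const_ge1 R n d; have C1 := drv_C D.
  have h1 : 0 < (@bilin_const R n d) ^+ 3 by rewrite exprn_gt0//; lra.
  have h2 : 0 < C ^+ 2 by rewrite exprn_gt0//; lra.
  by rewrite mulr_gt0 ?mulr_gt0//; lra.
set K := _ * _ * _ in c0.
have Xi_defect e : 0 < e -> exists2 h, 0 < h & forall s r t, 0 <= s -> s <= r ->
     r <= t -> t <= T -> t - s <= h ->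
     `|Xi V s r + Xi V r t - Xi V s t| <= e * (phi t - phi s) `^ (alpha * 3).
  move=> e0; pose e1 := Num.min 1 (e / K).
  have e10 : 0 < e1 by rewrite lt_min ltr01 divr_gt0.
  have e11 : e1 <= 1 by rewrite ge_min lexx.
  have [h1 h10 sc] := exists_scale D e10.
  have [h2 h20 hh2] := Vs e1 e10.
  have [h3 h30 hh3] := Rs e1 e10.
  exists (Num.min h1 (Num.min h2 h3)); first by rewrite !lt_min h10 h20.
  move=> s r t s0 sr rt tT; rewrite !le_min => /andP[d1 /andP[d2 d3]].
  have rT := le_trans rt tT; have r0 := le_trans s0 sr.
  have s0T : 0 <= s <= T by rewrite s0 (le_trans sr).
  have r0T : 0 <= r <= T by rewrite r0.
  have sub1 h : t - s <= h -> r - s <= h by move=> th; apply: le_trans th; rewrite lerB.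
  have sub2 h : t - s <= h -> t - r <= h by move=> th; apply: le_trans th; rewrite lerB.
  have [[_ bSg bSgd] [_ bR _]] := sc s r s0 sr rT (sub1 _ d1).
  have [[bX _ _] [bXX _ _]] := sc r t r0 rt tT (sub2 _ d1).
  have bV := hh2 s r s0 sr rT (sub1 _ d2).
  have bRV := hh3 s r s0 sr rT (sub1 _ d3).
  move: bRV; rewrite (control_powX _ _ _ _ 2) (control_powX _ _ _ _ 3).
  have qsr : (phi r - phi s) `^ alpha <= (phi t - phi s) `^ alpha.
    exact: (powR_subadd cphi (ltW (drv_alpha D))).
  have qrt : (phi t - phi r) `^ alpha <= (phi t - phi s) `^ alpha.
    exact: (powR_subadd cphi (ltW (drv_alpha D))).
  have sqr2 a b : 0 <= a -> a <= b -> a ^+ 2 <= b ^+ 2 :> R.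
    by move=> a0' ab; rewrite lerXn2r// nnegrE// (le_trans a0').
  have qsr2 := sqr2 _ _ (powR_ge0 _ _) qsr; have qrt2 := sqr2 _ _ (powR_ge0 _ _) qrt.
  move=> bRV; move: qsr qrt qsr2 qrt2; set Q := (phi t - phi s) `^ alpha => qsr qrt qsr2 qrt2.
  have up (a b b' : R) : a <= e1 * b -> b <= b' -> a <= e1 * b'.
    by move=> ab bb; apply: (le_trans ab); rewrite ler_wpM2l// ltW.
  have Xst : increment X s t = increment X s r + increment X r t.
    by rewrite /increment [RHS]addrC subrKA.
  have G := @germ_defect R n d (Sigma s) (Sigma' s) (Sigma r) (Sigma' r) (V s) (V r)
    (increment X s r) (increment X r t) (XX s r) (XX r t) C e1 Q Y 1.
  rewrite /Xi (drv_chen D s0 sr rt tT) Xst.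
  apply: (@le_trans _ _ (K * e1 ^+ 2 * Q ^+ 3)).
    apply: G.
    - exact: (drv_C D).
    - by rewrite e11 ltW.
    - exact: powR_ge0.
    - exact: (drv_Sigma D).
    - exact: (drv_Sigma' D).
    - exact: (drv_Sigma D).
    - exact: (drv_Sigma' D).
    - exact: up bSg _.
    - exact: up bSgd _.
    - exact: up bX _.
    - exact: up bR _.
    - exact: up bXX _.
    - exact: hY.
    - exact: hY.
    - by rewrite mul1r; exact: up bV _.
    - by rewrite mul1r -VdE//; exact: up bRV _.
  rewrite ler_wpM2r ?exprn_ge0 ?powR_ge0//.
  apply: (@le_trans _ _ (K * e1)).
    by rewrite ler_wpM2l ?(ltW c0)// expr2 ler_piMl// ltW.
  by rewrite mulrC -(ler_pdivlMr _ _ c0) ge_min lexx orbT.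
have Xi0 s : 0 <= s <= T -> Xi V s s = 0.
  move=> sT; have := one_step_id D (V s) sT; rewrite one_step_germ.
  have -> : B s s = 0.
    by have /esym/eqP := drv_B D s s s; rewrite -subr_eq0 addrK => /eqP.
  by rewrite mul0mx addr0 => /eqP; rewrite -subr_eq0 addrAC subrr add0r => /eqP.
have sew := additive_sewing cphi (drv_alpha3 D) Xi0 Xi_defect.
pose J t := V t - v - drift A V t.
have JP t : 0 <= t <= T -> is_rough_integral X XX (fun s => tensor_mul (Sigma s) (V s))
    (fun s => tensor_mul_deriv (Sigma s) (Sigma' s) (V s) (Vd s)) 0 t (J t).
  move=> tT; have [|J' [hJ VE]] := sol t; first by rewrite /= in_itv.
  suff -> : J t = J' by [].
  have gen (a b c : 'cV[R]_n) : a + b + c - a - b = c.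
    by apply/matrixP => i j; rewrite !(mx_addE, mx_oppE); ring.
  by rewrite /J VE gen.
have Jfine t e : 0 <= t <= T -> 0 < e -> exists2 h, 0 < h & forall pi,
    itv_partition 0 t pi -> mesh 0 pi < h ->
    `|\sum_(uv <- subintervals 0 pi) Xi V uv.1 uv.2 - J t| <= e.
  move=> /[dup] tT /andP[t0 tT'] e0.
  have VF := vanishing_mesh_filter t0.
  have /cvgrPdist_le/(_ e e0) := JP t tT.
  move=> [h /= h0 hh]; exists h => // pi pp pm.
  by rewrite -(rough_sum_germ VdE (lexx 0) tT' pp) distrC; apply: hh.
have Jsmall : small T phi (alpha * 3) (fun s t => J t - J s - Xi V s t).
  move=> e e0; have [h h0 hh] := sew e e0.
  exists h => // s t s0 st tT sth; apply/ler_addgt0Pr => g g0.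
  have g20 : 0 < g / 2 by rewrite divr_gt0.
  have s0T : 0 <= s <= T by rewrite s0 (le_trans st).
  have t0T : 0 <= t <= T by rewrite tT (le_trans s0).
  have [h1 h10 hh1] := Jfine s _ s0T g20.
  have [h2 h20 hh2] := Jfine t _ t0T g20.
  have h12 : 0 < Num.min h1 h2 by rewrite lt_min h10.
  have [pi1 pp1 pm1] := fine_partition h12 s0.
  have [pi2 pp2 pm2] := fine_partition h12 st.
  have last1 : last 0 pi1 = s by case: pp1 => _ /eqP.
  have pp12 := itv_partition_cat pp1 pp2.
  have pm12 : mesh 0 (pi1 ++ pi2) < Num.min h1 h2.
    by rewrite mesh_cat gt_max pm1 last1.
  move: pm1 pm12; rewrite !lt_min => /andP[m1 _] /andP[_ m12].
  have S1 := hh1 pi1 pp1 m1; have S2 := hh2 _ pp12 m12.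
  have S3 := hh s t pi2 s0 tT sth pp2.
  move: S2; rewrite subintervals_cat big_cat last1 /=.
  move: S1 S3; set s1 := bigop.body _ _ _; set s2 := bigop.body _ _ _.
  move=> S1 S3 S2.
  have -> : J t - J s - Xi V s t = - (s1 + s2 - J t) + (s1 - J s) + (s2 - Xi V s t).
    have gen (a b c f x : 'cV[R]_n) : a - b - c = - (f + x - a) + (f - b) + (x - c).
      by apply/matrixP => i j; rewrite !(mx_addE, mx_oppE); ring.
    exact: gen.
  apply: (le_trans (ler_normD _ _)).
  apply: (le_trans (lerD (ler_normD _ _) (lexx _))); rewrite normrN.
  by apply: (le_trans (lerD (lerD S2 S1) S3)); rewrite -splitr addrC.
have dr := drift_small Vc Vs.
have := smallD Jsmall dr; apply: (small_le (K := 1)) => s t s0 st tT.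
rewrite mul1r one_step_germ /J le_eqVlt; apply/orP; left; apply/eqP; congr (`| _ |).
have gen (a b c f x y z w : 'cV[R]_n) :
  a - (b + c + f) = a - x - y - (b - x - z) - f + (y - z - c).
  by apply/matrixP => i j; rewrite !(mx_addE, mx_oppE); ring.
exact: gen.
Qed.

(** The expansion gives the regularity of [V] at once, since the error has order
    [alpha * 3 > 1 >= 2 / p]; here the exact exponent [p] is recovered although
    the error was estimated with [alpha < 1 / p].  It also gives the equation: the
    increments of [V] minus the drift agree with the germ up to an error whose
    sums over fine partitions vanish, so the rough sums converge. *)
Lemma solution_of_expansion (v : 'cV[R]_n) (V : R -> 'cV[R]_n) :
  2 <= p < 3 -> alpha * p < 1 ->
  {within `[0, T], continuous X} -> {within `[0, T], continuous Sigma} ->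
  controls T phi p (increment X) -> controls T phi p (increment Sigma) ->
  controls T phi (p / 2) XX ->
  (forall s t, 0 <= s -> s <= t -> t <= T -> `|B s t| <= M * (t - s)) ->
  V 0 = v -> (exists2 N : R, 0 <= N & forall t, 0 <= t <= T -> `|V t| <= N) ->
  small T phi (alpha * 3) (fun s t => V t - P s t (V s)) ->
  is_solution p T v A X XX Sigma Sigma' V (fun t => tensor_mul (Sigma t) (V t)).
Proof.
move=> /andP[p2 p3] ap Xc Sc cX cS cXX Ble V0 [N N0 hN] Vexp.
have a0 := drv_alpha D; have a3 := drv_alpha3 D; have C1 := drv_C D.
have p0 : 0 < p by lra.
have p20 : 0 < p / 2 by rewrite divr_gt0.
have c1 := @bilin_const_ge1 R n d; have c0 := @bilin_const_ge0 R n d.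
have S0T s t : 0 <= s -> s <= t -> t <= T -> 0 <= s <= T by move=> ? st ?; rewrite (le_trans st) ?andbT.
have T0T s t : 0 <= s -> s <= t -> t <= T -> 0 <= t <= T by move=> s0 st ->; rewrite (le_trans s0).
(* the second-order part of the one-step map *)
pose Q s t := B s t *m V s + deriv_contract (lin_deriv (Sigma s) (Sigma' s) (V s)) (XX s t).
pose L s t := tensor_mul (Sigma s) (V s) *m increment X s t.
have PE s t : P s t (V s) = V s + (Q s t + L s t).
  have gen (a b c f : 'cV[R]_n) : a + b + (c + f) = a + ((b + f) + c).
    by apply/matrixP => i j; rewrite !mx_addE; ring.
  exact: gen.
have invp : p^-1 <= (p / 2)^-1.
  by rewrite lef_pV2 ?posrE// ler_pdivrMr//; lra.
have invp0 : 0 < p^-1 by rewrite invr_gt0.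
have invp20 : 0 < (p / 2)^-1 by rewrite invr_gt0.
have invp21 : (p / 2)^-1 <= 1.
  by rewrite invf_le1//; rewrite ler_pdivlMr//; lra.
have time_big : big T phi (p / 2)^-1 (fun s t => t - s).
  apply: (big_weaken cphi invp20 invp21); exists 1 => // s t s0 st tT.
  rewrite mul1r powRr1; last exact: (control_ge0 cphi).
  by rewrite ger0_norm ?subr_ge0//; exact: cphi.
have Qbig : big T phi (p / 2)^-1 Q.
  apply: bigD.
    apply: (big_le (K := bc * M * N) _ time_big) => s t s0 st tT.
    rewrite ger0_norm ?subr_ge0//.
    apply: (le_trans (@norm_mulmx_nn R n d _ _)).
    have b1 := Ble s t s0 st tT; have b2 := hN s (S0T s t s0 st tT).
    have -> : bc * M * N * (t - s) = bc * (M * (t - s)) * N by ring.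
    by apply: ler_pM; rewrite ?mulr_ge0// ler_wpM2l.
  have XXbig := controls_big cphi p20 (drv_XX0 D) cXX.
  apply: (big_le (K := bc * (2 * bc ^+ 2 * C ^+ 2 * N)) _ XXbig) => s t s0 st tT.
  apply: (le_trans (norm_deriv_contract _ _)); rewrite ler_wpM2r// ler_wpM2l//.
  have sT := S0T s t s0 st tT.
  apply: (le_trans (norm_lin_deriv _ C1 (drv_Sigma D sT) (drv_Sigma' D sT))).
  rewrite ler_wpM2l ?hN//.
  by rewrite mulr_ge0 ?sqr_ge0// mulr_ge0 ?sqr_ge0.
have Xdiag s : 0 <= s <= T -> increment X s s = 0 by move=> _; rewrite /increment subrr.
have Sdiag s : 0 <= s <= T -> increment Sigma s s = 0 by move=> _; rewrite /increment subrr.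
have Lbig : big T phi p^-1 L.
  apply: (big_le (K := bc * (bc * C * N)) _ (controls_big cphi p0 Xdiag cX)) => s t s0 st tT.
  have sT := S0T s t s0 st tT.
  apply: (le_trans (norm_mulmx_nd _ _)); rewrite ler_wpM2r// ler_wpM2l//.
  apply: (le_trans (norm_tensor_mul _ _)); apply: ler_pM; rewrite ?mulr_ge0//; last exact: hN.
  by rewrite ler_wpM2l// (drv_Sigma D).
have QL_big : big T phi p^-1 (fun s t => Q s t + L s t).
  exact: bigD (big_weaken cphi invp0 invp Qbig) Lbig.
(* the error of the expansion is of order alpha * 3 > 1, hence of order 2 / p *)
have Ebig : big T phi (p / 2)^-1 (fun s t => V t - P s t (V s)).
  have [K hK] := big_bounded cphi (ltW invp0) QL_big.
  have a31 : (p / 2)^-1 <= alpha * 3 by lra.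
  apply: (big_weaken cphi invp20 a31).
  apply: (small_big (M := N + (N + K)) cphi _ Vexp); first by lra.
  move=> s t s0 st tT; apply: (le_trans (ler_normB _ _)); rewrite PE.
  apply: lerD; first exact: hN (T0T s t s0 st tT).
  apply: (le_trans (ler_normD _ _)); apply: lerD; first exact: hN (S0T s t s0 st tT).
  exact: hK.
have dV_big : big T phi p^-1 (increment V).
  have := bigD (big_weaken cphi invp0 invp Ebig) QL_big.
  apply: (big_le (K := 1)) => s t s0 st tT; rewrite mul1r PE.
  have gen (a b c : 'cV[R]_n) : b - a = b - (a + c) + c by rewrite opprD addrA subrK.
  by rewrite /increment (gen (V s) (V t) (Q s t + L s t)).
have dV_small : small T phi alpha (increment V).
  move=> e e0.
  have K0 : 0 < @close_const R n d C * (N + 1).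
    by rewrite mulr_gt0 ?ltr_wpDl// (close_const_gt0 D).
  have [h1 h10 sc] := exists_scale D (divr_gt0 (divr_gt0 e0 (ltr0n _ 2)) K0).
  pose W := (phi T - phi 0) `^ (alpha * 2) + 1.
  have W0 : 0 < W by rewrite ltr_wpDl ?powR_ge0.
  have [h2 h20 hh2] := Vexp (e / 2 / W) (divr_gt0 (divr_gt0 e0 (ltr0n _ 2)) W0).
  exists (Num.min h1 h2); first by rewrite lt_min h10.
  move=> s t s0 st tT; rewrite le_min => /andP[d1 d2].
  have e1 : 0 <= e / 2 / (@close_const R n d C * (N + 1)) by rewrite ltW// divr_gt0// divr_gt0.
  have [+ _] := one_step_close D (V s) e1 sc s0 st tT d1.
  have b2 := hh2 s t s0 st tT d2.
  set q := _ `^ alpha => b1; have q0 : 0 <= q by exact: powR_ge0.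
  have {}b2 : `|V t - P s t (V s)| <= e / 2 * q.
    apply: (le_trans b2).
    have -> : (phi t - phi s) `^ (alpha * 3) = (phi t - phi s) `^ (alpha * 2) * q.
      by rewrite (control_powX _ _ _ _ 2) (control_powX _ _ _ _ 3) [RHS]mulrC -exprS.
    rewrite mulrA ler_wpM2r// mulrAC ler_pdivrMr// ler_wpM2l ?divr_ge0 ?(ltW e0)//.
    apply: (@le_trans _ _ ((phi T - phi 0) `^ (alpha * 2))); last by rewrite /W lerDl.
    by apply: (powR_subadd cphi) => //; rewrite mulr_ge0// ltW.
  have {}b1 : `|P s t (V s) - V s| <= e / 2 * q.
    apply: (le_trans b1).
    have D00 := close_const_gt0 D.
    apply: (@le_trans _ _ (@close_const R n d C * (e / 2 / (@close_const R n d C * (N + 1))) * q * (N + 1))).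
      rewrite ler_wpM2l//; last by have := hN s (S0T s t s0 st tT); lra.
      exact: mulr_ge0 (mulr_ge0 (ltW D00) e1) q0.
    rewrite le_eqVlt; apply/orP; left; apply/eqP; field.
    by rewrite !gt_eqF//; lra.
  have -> : increment V s t = (V t - P s t (V s)) + (P s t (V s) - V s).
    by rewrite /increment addrA subrK.
  by apply: (le_trans (ler_normD _ _)); apply: (le_trans (lerD b2 b1)); rewrite -mulrDl -splitr.
have Vc : {within `[0, T], continuous V}.
  exact/unif0_continuous/(small_unif0 cphi (ltW a0) dV_small).
have dY_le s t : 0 <= s -> s <= t -> t <= T ->
   `|increment (fun t => tensor_mul (Sigma t) (V t)) s t| <=
      bc * N * `|increment Sigma s t| + bc * C * `|increment V s t|.
  move=> s0 st tT.
  have -> : increment (fun t => tensor_mul (Sigma t) (V t)) s t =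
     tensor_mul (increment Sigma s t) (V t) + tensor_mul (Sigma s) (increment V s t).
    rewrite /increment tensor_mulDl tensor_mulNl tensor_mulDr tensor_mulNr.
    by rewrite addrA subrK.
  apply: (le_trans (ler_normD _ _)); apply: lerD; apply: (le_trans (norm_tensor_mul _ _)).
    by rewrite mulrAC ler_wpM2r// ler_wpM2l// hN// (T0T s t).
  by rewrite ler_wpM2r// ler_wpM2l// (drv_Sigma D)// (S0T s t).
have dY_big : big T phi p^-1 (increment (fun t => tensor_mul (Sigma t) (V t))).
  have Sb : big T phi p^-1 (fun s t => bc * N * `|increment Sigma s t| : R).
    apply: (big_le (K := bc * N) _ (controls_big cphi p0 Sdiag cS)) => s t _ _ _.
    by rewrite ger0_norm// !mulr_ge0.
  have Vb : big T phi p^-1 (fun s t => bc * C * `|increment V s t| : R).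
    apply: (big_le (K := bc * C) _ dV_big) => s t _ _ _.
    by rewrite ger0_norm// !mulr_ge0//; lra.
  apply: (big_le (K := 1) _ (bigD Sb Vb)) => s t s0 st tT; rewrite mul1r.
  by apply: (le_trans (dY_le s t s0 st tT)); exact: ler_norm.
have Yc : {within `[0, T], continuous (fun t => tensor_mul (Sigma t) (V t))}.
  apply: unif0_continuous => e e0.
  have K0 : 0 < bc * N + bc * C + 1.
    by rewrite ltr_wpDl// addr_ge0// mulr_ge0//; lra.
  have [h1 h10 hh1] := continuous_unif0 Sc (divr_gt0 e0 K0).
  have [h2 h20 hh2] := continuous_unif0 Vc (divr_gt0 e0 K0).
  exists (Num.min h1 h2); first by rewrite lt_min h10.
  move=> s t s0 st tT; rewrite le_min => /andP[d1 d2].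
  apply: (le_trans (dY_le s t s0 st tT)).
  set k := e / _ in hh1 hh2.
  apply: (@le_trans _ _ (bc * N * k + bc * C * k)).
    by apply: lerD; rewrite ler_wpM2l ?mulr_ge0 ?hh1 ?hh2//; lra.
  rewrite -mulrDl /k mulrCA -[leRHS]mulr1 ler_wpM2l ?(ltW e0)//.
  by rewrite ler_pdivrMr// mul1r lerDl.
split.
- split; [split => //|split => //|].
  + exact: big_finite_qvariation cphi p0 dV_big.
  + exact: big_finite_qvariation cphi p0 dY_big.
  apply: (big_finite_qvariation cphi p20).
  apply: (big_le (K := 1) _ (bigD Ebig Qbig)) => s t s0 st tT; rewrite mul1r PE.
  have gen (a b c f : 'cV[R]_n) : b - a - f = b - (a + (c + f)) + c.
    by apply/matrixP => i j; rewrite !(mx_addE, mx_oppE); ring.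
  by rewrite /remainder /increment (gen (V s) (V t) (Q s t) (L s t)).
- by [].
move=> t; rewrite /= in_itv /= => /andP[t0 tT].
exists (V t - v - drift A V t); split; last first.
  have gen (a b c : 'cV[R]_n) : a = b + c + (a - b - c).
    by apply/matrixP => i j; rewrite !(mx_addE, mx_oppE); ring.
  exact: gen.
pose H s t := (V t - drift A V t) - (V s - drift A V s) - Xi V s t.
have Hsmall : small T phi (alpha * 3) H.
  have := smallD Vexp (smallN (drift_small Vc dV_small)).
  apply: (small_le (K := 1)) => s r s0 sr rT; rewrite mul1r one_step_germ /H.
  have gen (a b c f x y : 'cV[R]_n) :
     a - b - (c - f) - x = a - (c + y + x) - (b - f - y).
    by apply/matrixP => i j; rewrite !(mx_addE, mx_oppE); ring.
  by rewrite (gen _ _ _ _ _ (B s r *m V s)).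
have VF := vanishing_mesh_filter t0.
apply/cvgrPdist_le => e e0.
have [h h0 hh] := small_sum_vanishes cphi (ltW a3) Hsmall e0.
exists h => //= pi [pp pm].
have := hh t pi tT pp pm.
rewrite (rough_sum_germ _ (lexx 0) tT pp)// sumrB.
rewrite (sum_subintervals_telescope (fun r => V r - drift A V r) pp) drift0 subr0 V0.
by rewrite [V t - drift A V t - v]addrAC.
Qed.

End solutions.

(** * Existence and uniqueness *)

Lemma rough_integral_point {R : realType} {n d : nat} (X : R -> 'cV[R]_d)
    (XX : R -> R -> 'M[R]_d) (Y : R -> 'M[R]_(n, d)) (Yd : R -> 'M[R]_(n * d, d))
    (s : R) (J : 'cV[R]_n) :
  is_rough_integral X XX Y Yd s s J -> J = 0.
Proof.
have VF := vanishing_mesh_filter (lexx s).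
move=> /cvgrPdist_le HJ; apply/eqP; rewrite -normr_eq0 eq_le normr_ge0 andbT.
apply/ler_addgt0Pl => e e0; rewrite addr0.
have [h /= h0 hh] := HJ e e0.
have [pi pp pm] := fine_partition h0 (lexx s).
have := hh pi (conj pp pm).
by rewrite (itv_partitionxx pp) /= /rough_sum /subintervals big_nil subr0.
Qed.

Theorem theorem3p10 (R : realType) (n d : nat) (p T : R) (v : 'cV[R]_n)
    (A : R -> 'M[R]_n)
    (X : R -> 'cV[R]_d) (XX : R -> R -> 'M[R]_d)
    (Sigma : R -> 'cV[R]_(n * d * n)) (Sigma' : R -> 'M[R]_(n * d * n, d))
    (hp : 2 <= p < 3) (hT : 0 < T)
    (hA : Linfty T A)
    (hX : rough_path p T X XX)
    (hSigma : controlled_path p T X Sigma Sigma') :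
  exists (V : R -> 'cV[R]_n) (V' : R -> 'M[R]_(n, d)),
    is_solution p T v A X XX Sigma Sigma' V V' /\
    forall (W : R -> 'cV[R]_n) (W' : R -> 'M[R]_(n, d)),
      is_solution p T v A X XX Sigma Sigma' W W' ->
      forall t : R, `[0, T]%classic t -> W t = V t /\ W' t = V' t.
Proof.
have T0 := ltW hT.
have [alpha [a0 a3 ap a2]] := exponent_choice hp.
have p0 : 0 < p by case/andP: hp => *; lra.
have p20 : 0 < p / 2 by rewrite divr_gt0.
have a20 : 0 < alpha * 2 by rewrite mulr_gt0.
have a2p : alpha * 2 * (p / 2) < 1.
  by have -> : alpha * 2 * (p / 2) = alpha * p by field.
have [M [B [M0 BD Ble drift_lin]]] := drift_linearization T0 hA.
have Xc : {within `[0, T], continuous X} by case: hX => -[].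
have Sc : {within `[0, T], continuous Sigma} by case: hSigma => -[].
have zero_ge0 s t : 0 <= s -> s < t -> t <= T -> 0 <= (fun=> 0 : R) t - (fun=> 0 : R) s.
  by rewrite subrr.
have [phi [C [D [_ cX cS cXX]]]] :=
  driver_of hp a0 a3 ap a2 hX hSigma BD Ble zero_ge0.
have cphi := drv_control D.
have [V [V0 Vbnd Vexp]] := euler_limit D T0 v.
have Vsol := solution_of_expansion D a2 M0 drift_lin hp ap Xc Sc cX cS cXX Ble V0 Vbnd Vexp.
exists V, (fun t => tensor_mul (Sigma t) (V t)); split => // W W' Wsol.
have [[[Wc Wv] [W'c _] Rv] W'E Weq] := Wsol.
have [f cf] := finite_qvariation_controls p0 Wv.
have [g cg] := finite_qvariation_controls p20 Rv.
(* one control for both solutions *)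
pose phi0 t := phi t + f t + g t.
have parts s t : 0 <= s -> s < t -> t <= T ->
    [/\ 0 <= phi t - phi s, 0 <= f t - f s & 0 <= g t - g s].
  move=> s0 st tT; split.
  - exact: control_ge0 cphi _ _ s0 (ltW st) tT.
  - exact: le_trans (powR_ge0 _ _) (cf s t s0 st tT).
  - exact: le_trans (powR_ge0 _ _) (cg s t s0 st tT).
have phi0_ge0 s t : 0 <= s -> s < t -> t <= T -> 0 <= phi0 t - phi0 s.
  by move=> s0 st tT; have [] := parts s t s0 st tT; rewrite /phi0; lra.
have [psi [K [D' [dom _ _ _]]]] :=
  driver_of hp a0 a3 ap a2 hX hSigma BD Ble phi0_ge0.
have cpsi := drv_control D'.
have doms s t : 0 <= s -> s < t -> t <= T -> [/\ phi t - phi s <= psi t - psi s,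
    f t - f s <= psi t - psi s & g t - g s <= psi t - psi s].
  move=> s0 st tT; have := dom s t s0 st tT; have [] := parts s t s0 st tT.
  by rewrite /phi0 => *; split; lra.
have Ws : small T psi alpha (increment W).
  apply: (controls_small cpsi p0 a0 ap (continuous_unif0 Wc)).
  by apply: (controls_le cf) => s t s0 st tT; have [] := doms s t s0 st tT.
have Rs : small T psi (alpha * 2) (remainder X W W').
  apply: (controls_small cpsi p20 a20 a2p (remainder_unif0 Xc Wc W'c)).
  by apply: (controls_le cg) => s t s0 st tT; have [] := doms s t s0 st tT.
have Wexp := expansion_of_solution D' a2 M0 drift_lin Wsol Ws Rs.
have Vexp' : small T psi (alpha * 3) (fun s t => V t - one_step X XX Sigma Sigma' B s t (V s)).
  apply: (small_mono cphi _ _ Vexp); first by lra.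
  by move=> s t s0 st tT; have [] := doms s t s0 st tT.
have W0 : W 0 = v.
  have [|J [HJ ->]] := Weq 0; first by rewrite /= in_itv /= lexx T0.
  by rewrite drift0 addr0 (rough_integral_point HJ) addr0.
have E0 : W 0 - V 0 = 0 by rewrite W0 V0 subrr.
have Eexp : small T psi (alpha * 3) (fun s t =>
    (W t - V t) - one_step X XX Sigma Sigma' B s t (W s - V s)).
  have := smallD Wexp (smallN Vexp'); apply: (small_le (K := 1)) => s r s0 sr rT.
  rewrite mul1r one_stepB.
  have gen (a b c e : 'cV[R]_n) : a - b - (c - e) = a - c - (b - e).
    by rewrite !opprB addrACA [RHS]addrACA [- b - c]addrC.
  by rewrite gen.
have WV t : 0 <= t <= T -> W t = V t.
  move=> tT; have /eqP := flow_unique D' (E := fun t => W t - V t) E0 Eexp tT.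
  by rewrite subr_eq0 => /eqP.
move=> t /= ; rewrite in_itv /= => tT; rewrite WV//; split => //.
by rewrite W'E ?WV// /= in_itv.
Qed.
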